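(* Let $q\ge 2$ be an integer, $s\in(0,2)$, and let $P(x,t)=|\Psi(x,t)|^2$ be as in the context. Then for any $T>0$ the graph of $P$ over $[0,\pi]\times[0,T]$, i.e. the surface $\{(x,t,P(x,t))\}\subset\mathbb R^3$, has box-counting dimension $D_{xt}=2+s/2$.
   Context: For an integer $q\ge2$ and $s\in(0,2)$ define, for $x\in[0,\pi]$ and $t\in\mathbb R$, $$\Psi(x,t)=N\sum_{n=0}^{\infty} q^{n(s-2)}\sin(q^n x)\,e^{-i q^{2n} t},\qquad N=\sqrt{\tfrac{2}{\pi}\big(1-q^{2(s-2)}\big)}.$$ Let $P(x,t)=|\Psi(x,t)|^2$. For a bounded set $A\subset\mathbb R^3$ let $N(\delta)$ be the number of cubes $[m_1\delta,(m_1+1)\delta]\times[m_2\delta,(m_2+1)\delta]\times[m_3\delta,(m_3+1)\delta]$, $m_i\in\mathbb Z$, meeting $A$. The box-counting dimension is $\lim_{\delta\to0}\ln N(\delta)/\ln(1/\delta)$ when this limit exists. *)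

(* Defs.v *)
From Stdlib Require Import Reals Lra ZArith List.
From Coquelicot Require Import Coquelicot.
Open Scope R_scope.

Definition coef (q : nat) (s : R) (n : nat) : R :=
  Rpower (INR q) (INR n * (s - 2)).

Definition Nrm (q : nat) (s : R) : R :=
  sqrt (2 / PI * (1 - Rpower (INR q) (2 * (s - 2)))).

(* Psi = N * sum coef_n sin(q^n x) e^{-i q^{2n} t}, split into real and
   imaginary parts: e^{-i th} = cos th - i sin th. *)
Definition Psi_re (q : nat) (s x t : R) : R :=
  Nrm q s * Series (fun n => coef q s n * sin (INR q ^ n * x) * cos (INR q ^ (2 * n) * t)).
Definition Psi_im (q : nat) (s x t : R) : R :=
  Nrm q s * Series (fun n => - (coef q s n * sin (INR q ^ n * x) * sin (INR q ^ (2 * n) * t))).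

Definition P (q : nat) (s x t : R) : R := Psi_re q s x t ^ 2 + Psi_im q s x t ^ 2.

Definition graphP (q : nat) (s T : R) (p : R * R * R) : Prop :=
  exists x t, 0 <= x <= PI /\ 0 <= t <= T /\ p = (x, t, P q s x t).

Definition cube_meets (A : R * R * R -> Prop) (d : R) (m : Z * Z * Z) : Prop :=
  let '(m1, m2, m3) := m in
  exists x y z, A (x, y, z) /\
    IZR m1 * d <= x <= (IZR m1 + 1) * d /\
    IZR m2 * d <= y <= (IZR m2 + 1) * d /\
    IZR m3 * d <= z <= (IZR m3 + 1) * d.

Definition box_count (A : R * R * R -> Prop) (d : R) (n : nat) : Prop :=
  exists l : list (Z * Z * Z), length l = n /\ NoDup l /\ forall m, In m l <-> cube_meets A d m.

Definition has_box_dim (A : R * R * R -> Prop) (D : R) : Prop :=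
  forall eps, 0 < eps -> exists d0, 0 < d0 /\
    forall d, 0 < d < d0 -> exists n, box_count A d n /\
      Rabs (ln (INR n) / ln (1 / d) - D) < eps.

(* Main.v *)
(* Write [P = N^2 |F|^2] with [F = sum_n a_n sin(q^n x) e^(i q^(2n) t)], [a_n = q^(n(s-2))].
   Splitting the series at [q^(2m) ~ 1/d] shows that [F], hence [P], varies by at most
   [C d^(1-s/2)] on a [d x d] square, which bounds the number of boxes from above.

   For the lower bound take the second difference in [t] with step [h = 2 PI / q^(2(m+1))].
   It annihilates every mode above the [m]-th, and the modes below contribute less than
   [0.43] times the amplitude of the [m]-th one.  Where [|F|] is bounded below (near
   [(PI/2, 0)]) one can choose [t] in a given square so that the [m]-th mode is in opposite
   phase with [F]; then [|F|^2] oscillates along [t] by at least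
   [c a_m (sin^2(q^m x) - 0.45)].  Summing over the squares, the Dirichlet kernel shows
   that [sin^2(q^m x)] has mean [1/2 > 0.45], which gives [c d^(1-s/2) / d^3] boxes. *)

Require Import Defs.
From Stdlib Require Import Reals Lra Lia ZArith List ClassicalEpsilon.
From Coquelicot Require Import Coquelicot.
Open Scope R_scope.

(** * Lacunary trigonometric series *)

Fixpoint rsum (u : nat -> R) (n : nat) : R :=
  match n with O => 0 | S k => rsum u k + u k end.

Lemma rsum_ext (u v : nat -> R) n :
  (forall i, (i < n)%nat -> u i = v i) -> rsum u n = rsum v n.
Proof.
  induction n as [|n IH]; intros H; simpl; [reflexivity|].
  rewrite IH by (intros; apply H; lia). rewrite H by lia. reflexivity.
Qed.

Lemma rsum_le (u v : nat -> R) n :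
  (forall i, (i < n)%nat -> u i <= v i) -> rsum u n <= rsum v n.
Proof.
  induction n as [|n IH]; intros H; simpl; [lra|].
  apply Rplus_le_compat; [apply IH; intros; apply H; lia | apply H; lia].
Qed.

Lemma rsum_scal (c : R) (u : nat -> R) n : rsum (fun i => c * u i) n = c * rsum u n.
Proof. induction n as [|n IH]; simpl; [|rewrite IH]; ring. Qed.

Lemma rsum_plus (u v : nat -> R) n :
  rsum (fun i => u i + v i) n = rsum u n + rsum v n.
Proof. induction n as [|n IH]; simpl; [|rewrite IH]; ring. Qed.

Lemma rsum_const (c : R) n : rsum (fun _ => c) n = INR n * c.
Proof. induction n as [|n IH]; simpl rsum; [simpl; ring|rewrite IH, S_INR; ring]. Qed.

Lemma rsum_Rabs (u : nat -> R) n : Rabs (rsum u n) <= rsum (fun i => Rabs (u i)) n.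
Proof.
  induction n as [|n IH]; simpl; [rewrite Rabs_R0; lra|].
  eapply Rle_trans; [apply Rabs_triang|lra].
Qed.

Lemma ex_series_geom_bounded (l B : R) (z : nat -> R) :
  0 < l < 1 -> (forall n, Rabs (z n) <= B) -> ex_series (fun n => l ^ n * z n).
Proof.
  intros Hl Hz. apply (ex_series_le (K := R_AbsRing) (V := R_CompleteNormedModule))
    with (fun n => B * l ^ n).
  - intros n. change norm with Rabs. rewrite Rabs_mult.
    rewrite (Rabs_pos_eq (l ^ n)) by (apply pow_le; lra).
    rewrite Rmult_comm. apply Rmult_le_compat_r; [apply pow_le; lra | apply Hz].
  - apply (ex_series_scal (K := R_AbsRing) (V := R_NormedModule) B).
    apply ex_series_geom. rewrite Rabs_pos_eq; lra.
Qed.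

Lemma Series_geom_bounded (l B : R) (z : nat -> R) :
  0 < l < 1 -> (forall n, Rabs (z n) <= B) ->
  Rabs (Series (fun n => l ^ n * z n)) <= B / (1 - l).
Proof.
  intros Hl Hz.
  assert (E : ex_series (fun n => B * l ^ n)).
  { apply (ex_series_scal (K := R_AbsRing) (V := R_NormedModule) B).
    apply ex_series_geom. rewrite Rabs_pos_eq; lra. }
  assert (Hb : forall n, Rabs (l ^ n * z n) <= B * l ^ n).
  { intros n. rewrite Rabs_mult.
    rewrite (Rabs_pos_eq (l ^ n)) by (apply pow_le; lra).
    rewrite Rmult_comm. apply Rmult_le_compat_r; [apply pow_le; lra | apply Hz]. }
  eapply Rle_trans.
  - apply Series_Rabs.
    apply (ex_series_le (K := R_AbsRing) (V := R_CompleteNormedModule))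
      with (fun n => B * l ^ n); [|exact E].
    intros n. change norm with Rabs. rewrite Rabs_Rabsolu. apply Hb.
  - eapply Rle_trans.
    + apply Series_le; [|exact E]. intros n; split; [apply Rabs_pos|apply Hb].
    + rewrite Series_scal_l, Series_geom by (rewrite Rabs_pos_eq; lra).
      unfold Rdiv; lra.
Qed.

Lemma Series_split (u : nat -> R) m :
  ex_series u -> Series u = rsum u m + Series (fun k => u (m + k)%nat).
Proof.
  intros E. induction m as [|m IH]; simpl rsum.
  - rewrite Rplus_0_l. reflexivity.
  - rewrite IH, (Series_incr_1 (fun k => u (m + k)%nat)).
    + rewrite Nat.add_0_r. rewrite (Series_ext (fun k => u (m + S k)%nat)
        (fun k => u (S m + k)%nat)); [ring|].
      intros n. f_equal. lia.
    + apply (ex_series_incr_n (K := R_AbsRing) (V := R_NormedModule) u m), E.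
Qed.

Lemma rsum_geom (r : R) n : r <> 1 -> rsum (fun i => r ^ i) n = (r ^ n - 1) / (r - 1).
Proof.
  intros Hr. induction n as [|n IH]; simpl; [|rewrite IH]; field; lra.
Qed.

(* Frequencies below [w ^ m] are estimated by their Lipschitz constants, the others
   by their amplitudes. *)
Lemma lacunary_Series_bound (l w d : R) (z : nat -> R) m :
  0 < l < 1 -> 1 < l * w -> 0 < d ->
  (forall n, Rabs (z n) <= 2) -> (forall n, Rabs (z n) <= 2 * w ^ n * d) ->
  Rabs (Series (fun n => l ^ n * z n))
    <= l ^ m * (2 * (w ^ m * d) / (l * w - 1) + 2 / (1 - l)).
Proof.
  intros Hl Hlw Hd H2 Hw.
  rewrite (Series_split _ m) by (apply (ex_series_geom_bounded l 2); auto).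
  eapply Rle_trans; [apply Rabs_triang|]. rewrite Rmult_plus_distr_l.
  assert (Hlm : 0 < l ^ m) by (apply pow_lt; lra).
  apply Rplus_le_compat.
  - eapply Rle_trans; [apply rsum_Rabs|].
    eapply Rle_trans; [apply (rsum_le _ (fun n => 2 * d * (l * w) ^ n))|].
    + intros n _. rewrite Rabs_mult, (Rabs_pos_eq (l ^ n)) by (apply pow_le; lra).
      rewrite Rpow_mult_distr.
      replace (2 * d * (l ^ n * w ^ n)) with (l ^ n * (2 * w ^ n * d)) by ring.
      apply Rmult_le_compat_l; [apply pow_le; lra|apply Hw].
    (* As [l * w > 1], the geometric sum is governed by its upper end [(l * w) ^ m]. *)
    + rewrite rsum_scal, rsum_geom by lra.
      replace (l ^ m * (2 * (w ^ m * d) / (l * w - 1)))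
        with (2 * d * ((l * w) ^ m / (l * w - 1)))
        by (rewrite Rpow_mult_distr; field; lra).
      apply Rmult_le_compat_l; [lra|]. unfold Rdiv.
      apply Rmult_le_compat_r; [|lra]. left; apply Rinv_0_lt_compat; lra.
  - rewrite (Series_ext _ (fun k => l ^ m * (l ^ k * z (m + k)%nat)))
      by (intros k; rewrite pow_add; ring).
    rewrite Series_scal_l, Rabs_mult, (Rabs_pos_eq (l ^ m)) by lra.
    apply Rmult_le_compat_l; [lra|]. apply Series_geom_bounded; auto.
Qed.

(** Descending from a large exponent, one stops at the first power whose predecessor is below [y];
    it exceeds [y] by at most one factor [w]. *)
Lemma pow_bracket (w y : R) : 1 < w -> 1 <= y -> exists m, y <= w ^ m <= y * w.
Proof.
  intros Hw Hy.
  destruct (Pow_x_infinity w ltac:(rewrite Rabs_pos_eq; lra) y) as [N HN].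
  specialize (HN N (le_n N)). rewrite Rabs_pos_eq in HN by (apply pow_le; lra).
  induction N as [|N IH].
  - exists O. simpl in *. nra.
  - destruct (Rle_dec y (w ^ N)) as [H|H].
    + apply IH. lra.
    + exists (S N). split; [lra|]. simpl. nra.
Qed.

(** * Sine and cosine as time factors; the two parts of [F] and their Hoelder bound *)

Lemma Rabs_sin_le (x : R) : Rabs (sin x) <= Rabs x.
Proof.
  assert (H : forall y, 0 <= y -> Rabs (sin y) <= y).
  { intros y Hy. destruct (Req_dec y 0) as [->|H0]; [rewrite sin_0, Rabs_R0; lra|].
    destruct (Rle_dec y 1) as [H1|H1].
    - rewrite Rabs_pos_eq; [left; apply sin_lt_x; lra|].
      apply sin_ge_0; [lra|]. generalize PI2_1. lra.
    - generalize (SIN_bound y); intros. apply Rabs_le. lra. }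
  destruct (Rle_dec 0 x) as [Hx|Hx].
  - rewrite (Rabs_pos_eq x) by lra. apply H; lra.
  - rewrite <- (Rabs_Ropp (sin x)), <- sin_neg, <- (Rabs_Ropp x), (Rabs_pos_eq (- x)) by lra.
    apply H; lra.
Qed.

Lemma sin_Lipschitz (a b : R) : Rabs (sin a - sin b) <= Rabs (a - b).
Proof.
  rewrite form4, !Rabs_mult, (Rabs_pos_eq 2) by lra.
  generalize (Rabs_sin_le ((a - b) / 2)).
  replace (Rabs ((a - b) / 2)) with (Rabs (a - b) / 2)
    by (unfold Rdiv; rewrite Rabs_mult, (Rabs_pos_eq (/ 2)); lra).
  assert (Rabs (cos ((a + b) / 2)) <= 1) by (apply Rabs_le, COS_bound).
  generalize (Rabs_pos (sin ((a - b) / 2))) (Rabs_pos (cos ((a + b) / 2))). nra.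
Qed.

Lemma cos_Lipschitz (a b : R) : Rabs (cos a - cos b) <= Rabs (a - b).
Proof.
  rewrite !cos_sin. replace (a - b) with (PI / 2 + a - (PI / 2 + b)) by ring.
  apply sin_Lipschitz.
Qed.

(** What the argument uses of the time factor: a bound, a Lipschitz constant, and the identity
    behind second differences. One treatment then serves real and imaginary parts. *)
Definition trig_like (g : R -> R) : Prop :=
  (forall a, Rabs (g a) <= 1) /\
  (forall a b, Rabs (g a - g b) <= Rabs (a - b)) /\
  (forall a b, g (a + b) + g (a - b) = 2 * cos b * g a).

Lemma trig_like_cos : trig_like cos.
Proof.
  repeat split.
  - intros a. apply Rabs_le, COS_bound.
  - apply cos_Lipschitz.
  - intros a b. rewrite cos_plus, cos_minus. ring.
Qed.

Lemma trig_like_sin : trig_like sin.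
Proof.
  repeat split.
  - intros a. apply Rabs_le, SIN_bound.
  - apply sin_Lipschitz.
  - intros a b. rewrite sin_plus, sin_minus. ring.
Qed.

(** For [g = cos] and [g = sin] these are the real and imaginary parts of [F]; [Psi] is [Nrm q s]
    times the conjugate of [F]. *)
Definition mode_sum (g : R -> R) (q : nat) (s x t : R) : R :=
  Series (fun n => coef q s n * sin (INR q ^ n * x) * g (INR q ^ (2 * n) * t)).

Lemma P_mode_sum q s x t :
  P q s x t = Nrm q s ^ 2 * (mode_sum cos q s x t ^ 2 + mode_sum sin q s x t ^ 2).
Proof. unfold P, Psi_re, Psi_im, mode_sum. rewrite Series_opp. ring. Qed.

Definition ratio (q : nat) (s : R) : R := Rpower (INR q) (s - 2).

Lemma INR_ge2 q : (2 <= q)%nat -> 2 <= INR q.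
Proof. intros H. apply le_INR in H. simpl in H. lra. Qed.

Lemma sq_ge4 q : (2 <= q)%nat -> 4 <= INR q ^ 2.
Proof. intros H. apply INR_ge2 in H. nra. Qed.

Lemma coef_pow q s n : coef q s n = ratio q s ^ n.
Proof.
  unfold coef, ratio. rewrite <- Rpower_pow by apply exp_pos.
  rewrite Rpower_mult. f_equal. ring.
Qed.

Lemma ratio_bounds q s : (2 <= q)%nat -> 0 < s < 2 -> 0 < ratio q s < 1.
Proof.
  intros Hq Hs. apply INR_ge2 in Hq. split; [apply exp_pos|].
  unfold ratio. rewrite <- (Rpower_O (INR q)) by lra. apply Rpower_lt; lra.
Qed.

(** The product is [q ^ s], so the Lipschitz constants in [t] of the modes grow geometrically
    although their amplitudes decay. *)
Lemma ratio_sq q s : (2 <= q)%nat -> 0 < s < 2 -> 1 < ratio q s * INR q ^ 2.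
Proof.
  intros Hq Hs. apply INR_ge2 in Hq. unfold ratio.
  rewrite <- (Rpower_pow 2) by lra. rewrite <- Rpower_plus.
  rewrite <- (Rpower_O (INR q)) at 1 by lra. apply Rpower_lt; simpl; lra.
Qed.

Lemma ex_series_mode_sum g q s x t : (2 <= q)%nat -> 0 < s < 2 -> trig_like g ->
  ex_series (fun n => coef q s n * sin (INR q ^ n * x) * g (INR q ^ (2 * n) * t)).
Proof.
  intros Hq Hs [Hg _].
  apply ex_series_ext with
    (fun n => ratio q s ^ n * (sin (INR q ^ n * x) * g (INR q ^ (2 * n) * t))).
  { intros n. rewrite coef_pow. match goal with |- ?a = ?b => change (@eq R a b) end. ring. }
  apply (ex_series_geom_bounded _ 1); [apply ratio_bounds; auto|].
  intros n. rewrite Rabs_mult.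
  assert (Rabs (sin (INR q ^ n * x)) <= 1) by (apply Rabs_le, SIN_bound).
  specialize (Hg (INR q ^ (2 * n) * t)).
  generalize (Rabs_pos (sin (INR q ^ n * x))) (Rabs_pos (g (INR q ^ (2 * n) * t))). nra.
Qed.

Lemma mode_sum_bound g q s x t : (2 <= q)%nat -> 0 < s < 2 -> trig_like g ->
  Rabs (mode_sum g q s x t) <= / (1 - ratio q s).
Proof.
  intros Hq Hs [Hg _]. unfold mode_sum.
  rewrite (Series_ext _
    (fun n => ratio q s ^ n * (sin (INR q ^ n * x) * g (INR q ^ (2 * n) * t))))
    by (intros n; rewrite coef_pow; ring).
  replace (/ (1 - ratio q s)) with (1 / (1 - ratio q s)) by (unfold Rdiv; ring).
  apply Series_geom_bounded; [apply ratio_bounds; auto|].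
  intros n. rewrite Rabs_mult.
  assert (Rabs (sin (INR q ^ n * x)) <= 1) by (apply Rabs_le, SIN_bound).
  specialize (Hg (INR q ^ (2 * n) * t)).
  generalize (Rabs_pos (sin (INR q ^ n * x))) (Rabs_pos (g (INR q ^ (2 * n) * t))). nra.
Qed.

(** Since [q ^ n <= q ^ (2 * n)], the increments in [x] and in [t] both obey the Lipschitz constant
    of the time factor; the product rule adds them to [2 * q ^ (2 * n) * d]. *)
Lemma mode_sum_increment g q s x t x' t' d m :
  (2 <= q)%nat -> 0 < s < 2 -> trig_like g -> 0 < d ->
  Rabs (x - x') <= d -> Rabs (t - t') <= d ->
  Rabs (mode_sum g q s x t - mode_sum g q s x' t')
    <= ratio q s ^ m * (2 * ((INR q ^ 2) ^ m * d) / (ratio q s * INR q ^ 2 - 1)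
                        + 2 / (1 - ratio q s)).
Proof.
  intros Hq Hs Hg Hd Hx Ht. unfold mode_sum.
  rewrite <- Series_minus by (apply ex_series_mode_sum; auto).
  rewrite (Series_ext _ (fun n => ratio q s ^ n *
     (sin (INR q ^ n * x) * g (INR q ^ (2 * n) * t)
      - sin (INR q ^ n * x') * g (INR q ^ (2 * n) * t'))))
    by (intros n; rewrite coef_pow; ring).
  destruct Hg as (Hg1 & Hg2 & _).
  apply lacunary_Series_bound;
    [apply ratio_bounds; auto | apply ratio_sq; auto | exact Hd | |]; intros n;
    set (A := sin (INR q ^ n * x)); set (A' := sin (INR q ^ n * x'));
    set (B := g (INR q ^ (2 * n) * t)); set (B' := g (INR q ^ (2 * n) * t'));
    assert (HA : Rabs A <= 1) by (apply Rabs_le, SIN_bound);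
    assert (HA' : Rabs A' <= 1) by (apply Rabs_le, SIN_bound);
    assert (HB : Rabs B <= 1) by apply Hg1;
    assert (HB' : Rabs B' <= 1) by apply Hg1.
  - apply Rabs_le_between in HA, HA', HB, HB'. apply Rabs_le. nra.
  - assert (Hq1 : 1 <= INR q ^ n) by (apply pow_R1_Rle; apply INR_ge2 in Hq; lra).
    rewrite <- pow_mult.
    assert (E2 : INR q ^ (2 * n) = INR q ^ n * INR q ^ n)
      by (rewrite <- pow_add; f_equal; lia).
    assert (H1 : Rabs (A - A') <= INR q ^ (2 * n) * d).
    { eapply Rle_trans; [apply sin_Lipschitz|].
      rewrite <- Rmult_minus_distr_l, Rabs_mult, Rabs_pos_eq by lra.
      rewrite E2, Rmult_assoc. apply Rmult_le_compat_l; [lra|]. nra. }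
    assert (H2 : Rabs (B - B') <= INR q ^ (2 * n) * d).
    { eapply Rle_trans; [apply Hg2|].
      rewrite <- Rmult_minus_distr_l, Rabs_mult, Rabs_pos_eq by (rewrite E2; nra).
      apply Rmult_le_compat_l; [rewrite E2; nra|exact Ht]. }
    replace (A * B - A' * B') with ((A - A') * B + A' * (B - B')) by ring.
    eapply Rle_trans; [apply Rabs_triang|]. rewrite !Rabs_mult.
    generalize (Rabs_pos (A - A')) (Rabs_pos (B - B')) (Rabs_pos A') (Rabs_pos B). nra.
Qed.

(* Solving [c <= q^(2m) d <= c q^2] for [m] turns [ratio ^ m] into [d ^ (1 - s/2)]. *)
Lemma ratio_pow_Rpower q s c d m :
  (2 <= q)%nat -> 0 < s < 2 -> 0 < c -> 0 < d ->
  c <= (INR q ^ 2) ^ m * d <= c * INR q ^ 2 ->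
  Rpower (c * INR q ^ 2) (- (1 - s / 2)) * Rpower d (1 - s / 2) <= ratio q s ^ m
    <= Rpower c (- (1 - s / 2)) * Rpower d (1 - s / 2).
Proof.
  intros Hq Hs Hc Hd [H1 H2]. apply INR_ge2 in Hq.
  assert (Hw : 0 < INR q ^ 2) by (apply pow_lt; lra).
  (* Exact, because [ratio q s] is [q ^ 2] to the power [- (1 - s / 2)]; the bracket on
     [(q ^ 2) ^ m * d] enters only afterwards. *)
  assert (E : ratio q s ^ m
    = Rpower ((INR q ^ 2) ^ m * d) (- (1 - s / 2)) * Rpower d (1 - s / 2)).
  { rewrite <- (Rpower_pow m) by apply exp_pos. unfold ratio. rewrite Rpower_mult.
    rewrite <- Rpower_mult_distr by (try apply pow_lt; lra).
    rewrite <- (Rpower_pow m (INR q ^ 2)) by lra.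
    rewrite <- (Rpower_pow 2 (INR q)), !Rpower_mult by lra.
    rewrite Rmult_assoc, <- Rpower_plus.
    replace (- (1 - s / 2) + (1 - s / 2)) with 0 by ring.
    rewrite (Rpower_O d), Rmult_1_r by lra. f_equal. simpl. field. }
  rewrite E.
  assert (M : forall a b, 0 < a -> a <= b -> Rpower b (- (1 - s / 2)) <= Rpower a (- (1 - s / 2))).
  { intros a b Ha Hab. assert (ln a <= ln b) by (apply ln_le; lra).
    destruct (Req_dec (ln a) (ln b)) as [He|He]; unfold Rpower; [rewrite He; lra|].
    left. apply exp_increasing. nra. }
  split; apply Rmult_le_compat_r; try (left; apply exp_pos); apply M; lra.
Qed.

(** With [m] chosen so that [1 <= q ^ (2 * m) * d <= q ^ 2], low and high frequencies both
    contribute at most a constant times [ratio q s ^ m <= d ^ (1 - s / 2)]. *)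
Lemma mode_sum_Hoelder q s : (2 <= q)%nat -> 0 < s < 2 ->
  exists K, 0 < K /\ forall g x t x' t' d, trig_like g -> 0 < d <= 1 ->
    Rabs (x - x') <= d -> Rabs (t - t') <= d ->
    Rabs (mode_sum g q s x t - mode_sum g q s x' t') <= K * Rpower d (1 - s / 2).
Proof.
  intros Hq Hs.
  generalize (sq_ge4 q Hq) (ratio_bounds q s Hq Hs) (ratio_sq q s Hq Hs); intros Hw Hl Hlw.
  set (C := 2 * INR q ^ 2 / (ratio q s * INR q ^ 2 - 1) + 2 / (1 - ratio q s)).
  assert (HC : 0 < C).
  { unfold C. apply Rplus_lt_0_compat; apply Rdiv_lt_0_compat; lra. }
  exists C. split; [exact HC|].
  intros g x t x' t' d Hg Hd Hx Ht.
  destruct (pow_bracket (INR q ^ 2) (/ d)) as [m Hm].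
  { lra. } { rewrite <- Rinv_1. apply Rinv_le_contravar; lra. }
  assert (Hm' : 1 <= (INR q ^ 2) ^ m * d <= 1 * INR q ^ 2).
  { replace 1 with (/ d * d) by (field; lra). split.
    - apply Rmult_le_compat_r; lra.
    - replace (/ d * d * INR q ^ 2) with (/ d * INR q ^ 2 * d) by ring.
      apply Rmult_le_compat_r; lra. }
  destruct (ratio_pow_Rpower q s 1 d m Hq Hs ltac:(lra) ltac:(lra) Hm') as [_ Hr].
  replace (Rpower 1 (- (1 - s / 2))) with 1 in Hr
    by (unfold Rpower; rewrite ln_1, Rmult_0_r, exp_0; reflexivity).
  eapply Rle_trans; [apply (mode_sum_increment g q s x t x' t' d m); auto; lra|].
  rewrite (Rmult_comm C). apply Rmult_le_compat.
  - apply pow_le; lra.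
  - apply Rplus_le_le_0_compat; apply Rlt_le, Rdiv_lt_0_compat; lra.
  - lra.
  - unfold C. apply Rplus_le_compat_r. unfold Rdiv. apply Rmult_le_compat_r.
    + left; apply Rinv_0_lt_compat; lra.
    + lra.
Qed.

(** * Counting boxes of a graph *)

(** Slices with different values of [c] are disjoint, so lower bounds for their sizes add up. Used
    in turn for the third, second and first index of a box. *)
Lemma disjoint_slices_count {A : Type} (Q : A -> Prop) (c : A -> Z) (a0 : Z)
    (V : nat -> R) (k : nat) :
  (forall i, (i < k)%nat -> exists l, NoDup l /\
     (forall a, In a l -> Q a /\ c a = (a0 + Z.of_nat i)%Z) /\ V i <= INR (length l)) ->
  exists l, NoDup l /\
    (forall a, In a l -> Q a /\ (a0 <= c a < a0 + Z.of_nat k)%Z) /\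
    rsum V k <= INR (length l).
Proof.
  induction k as [|k IH]; intros H.
  - exists nil. repeat split; [constructor|contradiction|contradiction|contradiction|].
    simpl; lra.
  - destruct IH as (l & N & Hl & Hn); [intros i Hi; apply H; lia|].
    destruct (H k ltac:(lia)) as (l' & N' & Hl' & Hn').
    exists (l' ++ l). repeat split.
    + apply NoDup_app; auto. intros a Ha Hb.
      apply Hl' in Ha. apply Hl in Hb. lia.
    + apply in_app_or in H0. destruct H0 as [H0|H0]; [apply Hl'|apply Hl]; auto.
    + apply in_app_or in H0. destruct H0 as [H0|H0]; [apply Hl' in H0|apply Hl in H0]; lia.
    + apply in_app_or in H0. destruct H0 as [H0|H0]; [apply Hl' in H0|apply Hl in H0]; lia.
    + rewrite length_app, plus_INR. simpl. lra.
Qed.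

(** Upper counterpart of [disjoint_slices_count]: covers are concatenated, and repetitions do no
    harm. *)
Lemma slices_cover {A : Type} (Q : A -> Prop) (c : A -> Z) (a0 : Z) (H : R) (k : nat) :
  (forall i, (i < k)%nat -> exists l, INR (length l) <= H /\
     (forall a, Q a -> c a = (a0 + Z.of_nat i)%Z -> In a l)) ->
  exists l, INR (length l) <= INR k * H /\
    (forall a, Q a -> (a0 <= c a < a0 + Z.of_nat k)%Z -> In a l).
Proof.
  induction k as [|k IH]; intros HH.
  - exists nil. split; [simpl; lra|]. intros; lia.
  - destruct IH as (l & Hn & Hl); [intros i Hi; apply HH; lia|].
    destruct (HH k ltac:(lia)) as (l' & Hn' & Hl').
    exists (l' ++ l). split.
    + rewrite length_app, plus_INR, S_INR. lra.
    + intros a Ha Hc. apply in_or_app.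
      destruct (Z.eq_dec (c a) (a0 + Z.of_nat k)) as [E|E]; [left|right]; auto.
      apply Hl; auto; lia.
Qed.

Lemma integers_between (a b : R) : a <= b ->
  exists (lo : Z) (k : nat), INR k <= b - a + 2 /\
    forall m, a <= IZR m <= b -> (lo <= m < lo + Z.of_nat k)%Z.
Proof.
  intros Hab. destruct (archimed a) as [A1 A2]. destruct (archimed b) as [B1 B2].
  assert (Hle : (up a <= up b)%Z).
  { apply Z.lt_succ_r, lt_IZR. rewrite succ_IZR. lra. }
  (* [up a] lies strictly above [a], so the range starts one lower in case [a] is itself an
     integer. *)
  exists (up a - 1)%Z, (Z.to_nat (up b - up a + 1)). split.
  - rewrite INR_IZR_INZ, Z2Nat.id by lia. rewrite plus_IZR, minus_IZR. lra.
  - intros m [M1 M2]. rewrite Z2Nat.id by lia.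
    assert (up a - 1 < m + 1)%Z by (apply lt_IZR; rewrite minus_IZR, plus_IZR; lra).
    assert (m < up b)%Z by (apply lt_IZR; lra). lia.
Qed.

(** Removing repetitions and, by a classical test, the boxes that miss [A] leaves exactly the list
    that [box_count] asks for. *)
Lemma box_count_of_cover A d l :
  (forall m, cube_meets A d m -> In m l) ->
  exists n, box_count A d n /\ (n <= length l)%nat.
Proof.
  intros Hl.
  assert (dec : forall x y : Z * Z * Z, {x = y} + {x <> y}) by (repeat decide equality).
  set (test := fun m => if excluded_middle_informative (cube_meets A d m) then true else false).
  set (l' := filter test (nodup dec l)).
  assert (N : NoDup l') by apply NoDup_filter, NoDup_nodup.
  exists (length l'). split.
  - exists l'. repeat split; auto; unfold l'; rewrite filter_In; unfold test;
      destruct excluded_middle_informative as [H|H].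
    + intros; exact H.
    + intros [_ H']; discriminate.
    + intros; split; auto. apply nodup_In; auto.
    + contradiction.
  - apply NoDup_incl_length; auto. intros m Hm. apply filter_In in Hm.
    destruct Hm as [Hm _]. apply nodup_In in Hm. exact Hm.
Qed.

(** [graphP q s T] is convertible to [graph_over (P q s) PI T]. *)
Definition graph_over (f : R -> R -> R) (X T : R) (p : R * R * R) : Prop :=
  exists x t, 0 <= x <= X /\ 0 <= t <= T /\ p = (x, t, f x t).

Lemma cube_side (m : Z) (d x : R) : 0 < d ->
  IZR m * d <= x <= (IZR m + 1) * d <-> x / d - 1 <= IZR m <= x / d.
Proof.
  intros Hd. assert (E : x = x / d * d) by (field; lra).
  rewrite E at 1 2. split; intros [H1 H2]; split.
  - apply Rmult_le_reg_r in H2; lra.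
  - apply Rmult_le_reg_r in H1; lra.
  - apply Rmult_le_compat_r; lra.
  - apply Rmult_le_compat_r; lra.
Qed.

(** Over one cell all values lie within [H] of the value at its corner, so a column has at most
    [2 * H / d + 3] boxes; the other two factors count the columns. *)
Lemma graph_box_count_upper (f : R -> R -> R) (X T d H : R) :
  0 < X -> 0 < T -> 0 < d -> 0 <= H ->
  (forall x t x' t', Rabs (x - x') <= d -> Rabs (t - t') <= d ->
     Rabs (f x t - f x' t') <= H) ->
  exists n, box_count (graph_over f X T) d n /\
    INR n <= (X / d + 3) * ((T / d + 3) * (2 * H / d + 3)).
Proof.
  intros HX HT Hd HH Hf.
  assert (PX : 0 < X / d) by (apply Rdiv_lt_0_compat; lra).
  assert (PT : 0 < T / d) by (apply Rdiv_lt_0_compat; lra).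
  assert (PH : 0 <= 2 * H / d) by (apply Rmult_le_pos; [lra|left; apply Rinv_0_lt_compat; lra]).
  set (Q := cube_meets (graph_over f X T) d).
  assert (Hcol : forall m1 m2, exists l, INR (length l) <= 2 * H / d + 3 /\
    forall m, Q m -> fst (fst m) = m1 /\ snd (fst m) = m2 -> In m l).
  (* The corner may lie outside the domain of the graph; the bound on [f] holds on the whole
     plane. *)
  { intros m1 m2. set (z0 := f (IZR m1 * d) (IZR m2 * d)).
    destruct (integers_between ((z0 - H) / d - 1) ((z0 + H) / d)) as (lo & k & Hk & Hlo).
    { unfold Rdiv in *. nra. }
    destruct (slices_cover (fun m => Q m /\ fst (fst m) = m1 /\ snd (fst m) = m2)
       snd lo 1 k) as (l & Hl1 & Hl2).
    { intros i _. exists ((m1, m2, (lo + Z.of_nat i)%Z) :: nil). split; [simpl; lra|].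
      intros [[a b] c] (_ & E1 & E2) E3. simpl in *. left. congruence. }
    exists l. split.
    - replace (2 * H / d + 3) with ((z0 + H) / d - ((z0 - H) / d - 1) + 2) by (field; lra).
      lra.
    - intros m Hm Em. apply Hl2; [auto|]. apply Hlo.
      destruct m as [[a b] c]. simpl in *. destruct Em as [-> ->].
      destruct Hm as (x & y & z & (x' & t' & _ & _ & E) & Hx & Hy & Hz).
      injection E as -> -> ->.
      assert (D : Rabs (f x' t' - z0) <= H).
      { apply Hf; apply Rabs_le; lra. }
      apply Rabs_le_between in D.
      apply cube_side in Hz; [|exact Hd].
      assert (0 < / d) by (apply Rinv_0_lt_compat; lra).
      unfold Rdiv in *. nra. }
  (* Boxes are closed, so the cell of index -1 touches 0. *)
  destruct (integers_between (-1) (T / d) ltac:(lra)) as (lo2 & k2 & Hk2 & Hlo2).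
  destruct (integers_between (-1) (X / d) ltac:(lra)) as (lo1 & k1 & Hk1 & Hlo1).
  destruct (slices_cover Q (fun m => fst (fst m)) lo1 ((T / d + 3) * (2 * H / d + 3)) k1)
    as (l & Hl1 & Hl2).
  { intros i _.
    destruct (slices_cover (fun m => Q m /\ fst (fst m) = (lo1 + Z.of_nat i)%Z)
       (fun m => snd (fst m)) lo2 (2 * H / d + 3) k2) as (l & Hl1 & Hl2).
    { intros j _. destruct (Hcol (lo1 + Z.of_nat i)%Z (lo2 + Z.of_nat j)%Z) as (l & L1 & L2).
      exists l. split; [exact L1|]. intros a [Ha Ea] Eb. apply L2; auto. }
    exists l. split.
    - eapply Rle_trans; [exact Hl1|]. apply Rmult_le_compat_r; lra.
    - intros a Ha Ea. apply Hl2; auto. apply Hlo2.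
      destruct a as [[a b] c]. simpl.
      destruct Ha as (x & y & z & (x' & t' & _ & Ht & E) & _ & Hy & _).
      injection E as -> -> ->. apply cube_side in Hy; [|exact Hd].
      assert (0 <= t' / d <= T / d).
      { split; unfold Rdiv; [apply Rmult_le_pos|apply Rmult_le_compat_r];
          try lra; left; apply Rinv_0_lt_compat; lra. }
      lra. }
  destruct (box_count_of_cover (graph_over f X T) d l) as (n & Hn & Hnl).
  { intros m Hm. apply Hl2; auto. apply Hlo1. destruct m as [[a b] c]. simpl.
    destruct Hm as (x & y & z & (x' & t' & Hx & _ & E) & Hy & _).
    injection E as -> -> ->. apply cube_side in Hy; [|exact Hd].
    assert (0 <= x' / d <= X / d).
    { split; unfold Rdiv; [apply Rmult_le_pos|apply Rmult_le_compat_r];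
        try lra; left; apply Rinv_0_lt_compat; lra. }
    lra. }
  exists n. split; [exact Hn|]. apply le_INR in Hnl.
  eapply Rle_trans; [exact Hnl|]. eapply Rle_trans; [exact Hl1|].
  apply Rmult_le_compat_r; [apply Rmult_le_pos; lra|lra].
Qed.

(** By the intermediate value theorem on the segment from [t] to [t'], every box of the column
    between the heights [f x t] and [f x t'] is met. *)
Lemma column_count (f : R -> R -> R) (X T d : R) (m1 m2 : Z) (x t t' : R) :
  0 < d -> continuity (f x) ->
  0 <= x <= X -> 0 <= t <= T -> 0 <= t' <= T ->
  IZR m1 * d <= x <= (IZR m1 + 1) * d ->
  IZR m2 * d <= t <= (IZR m2 + 1) * d -> IZR m2 * d <= t' <= (IZR m2 + 1) * d ->
  exists l, NoDup l /\
    (forall m, In m l -> cube_meets (graph_over f X T) d m /\ fst m = (m1, m2)) /\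
    (f x t' - f x t) / d <= INR (length l).
Proof.
  intros Hd Hc Hx Ht Ht' Cx Ct Ct'.
  destruct (Rle_dec (f x t') (f x t)) as [Hle|Hlt].
  { exists nil. repeat split; [constructor|contradiction|contradiction|].
    simpl. apply Rmult_le_reg_r with d; [lra|].
    unfold Rdiv. rewrite Rmult_assoc, Rinv_l by lra. lra. }
  set (a := f x t / d). set (b := f x t' / d).
  assert (Hab : a <= b).
  { unfold a, b, Rdiv. apply Rmult_le_compat_r; [left; apply Rinv_0_lt_compat|]; lra. }
  assert (Ea : f x t = a * d) by (unfold a; field; lra).
  assert (Eb : f x t' = b * d) by (unfold b; field; lra).
  destruct (base_Int_part a) as [A1 A2]. destruct (base_Int_part b) as [B1 B2].
  assert (Hle : (Int_part a <= Int_part b)%Z).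
  { apply Z.lt_succ_r, lt_IZR. rewrite succ_IZR. lra. }
  destruct (disjoint_slices_count
    (fun m => cube_meets (graph_over f X T) d m /\ fst m = (m1, m2)) snd (Int_part a)
    (fun _ => 1) (Z.to_nat (Int_part b - Int_part a + 1))) as (l & N & Hl & Hn).
  - intros i Hi. assert (Hi' : (Z.of_nat i <= Int_part b - Int_part a)%Z) by lia.
    exists ((m1, m2, (Int_part a + Z.of_nat i)%Z) :: nil).
    split; [repeat constructor; intros []|]. split; [|simpl; lra].
    intros m [<-|[]]. simpl. split; [|reflexivity]. split; [|reflexivity].
    set (M := (Int_part a + Z.of_nat i)%Z).
    assert (HMb : IZR M <= b).
    { apply Rle_trans with (IZR (Int_part b)); [apply IZR_le; unfold M; lia|lra]. }
    assert (HMa : a <= IZR M + 1).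
    { assert (IZR (Int_part a) <= IZR M) by (apply IZR_le; unfold M; lia). lra. }
    (* Height, in units of [d], at which box [M] is met: its bottom, or [a] in the lowest box. *)
    set (z := Rmax a (IZR M)).
    assert (Hz : a <= z <= b /\ IZR M <= z <= IZR M + 1).
    { unfold z, Rmax. destruct Rle_dec; lra. }
    destruct (IVT_gen (f x) t t' (z * d) Hc) as (u & Hu & Eu).
    { rewrite Ea, Eb, Rmin_left, Rmax_right by nra. nra. }
    assert (Hu' : Rmin t t' = t /\ Rmax t t' = t' \/ Rmin t t' = t' /\ Rmax t t' = t).
    { unfold Rmin, Rmax. destruct Rle_dec; auto. }
    exists x, u, (z * d). split; [|split; [exact Cx|split; [|nra]]].
    + exists x, u. rewrite Eu. split; [exact Hx|]. split; [|reflexivity].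
      destruct Hu' as [[E1 E2]|[E1 E2]]; rewrite E1, E2 in Hu; lra.
    + destruct Hu' as [[E1 E2]|[E1 E2]]; rewrite E1, E2 in Hu; lra.
  - exists l. split; [exact N|]. split.
    + intros m Hm. apply Hl in Hm. tauto.
    + rewrite rsum_const, INR_IZR_INZ, Z2Nat.id in Hn by lia.
      rewrite plus_IZR, minus_IZR in Hn.
      replace ((f x t' - f x t) / d) with (b - a) by (unfold a, b; field; lra). lra.
Qed.

(** Each cell of a [k1] by [k2] block contributes at least [V i / d] boxes, and different cells have
    different boxes. [V] depends on the position in [x] alone and may be negative. *)
Lemma graph_box_count_lower (f : R -> R -> R) (X T d : R) (a1 a2 : Z) (k1 k2 : nat)
    (V : nat -> R) (n : nat) :
  0 < d -> (forall x, continuity (f x)) ->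
  (forall i j, (i < k1)%nat -> (j < k2)%nat -> exists x t t',
     0 <= x <= X /\ 0 <= t <= T /\ 0 <= t' <= T /\
     IZR (a1 + Z.of_nat i) * d <= x <= (IZR (a1 + Z.of_nat i) + 1) * d /\
     IZR (a2 + Z.of_nat j) * d <= t <= (IZR (a2 + Z.of_nat j) + 1) * d /\
     IZR (a2 + Z.of_nat j) * d <= t' <= (IZR (a2 + Z.of_nat j) + 1) * d /\
     V i <= f x t' - f x t) ->
  box_count (graph_over f X T) d n ->
  INR k2 * rsum V k1 / d <= INR n.
Proof.
  intros Hd Hc HV (L & <- & NL & HL).
  set (Q := cube_meets (graph_over f X T) d).
  destruct (disjoint_slices_count Q (fun m => fst (fst m)) a1
    (fun i => INR k2 / d * V i) k1) as (l & N & Hl & Hn).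
  { intros i Hi.
    destruct (disjoint_slices_count (fun m => Q m /\ fst (fst m) = (a1 + Z.of_nat i)%Z)
      (fun m => snd (fst m)) a2 (fun j => V i / d) k2) as (l & N & Hl & Hn).
    { intros j Hj.
      destruct (HV i j Hi Hj) as (x & t & t' & Hx & Ht & Ht' & Cx & Ct & Ct' & HVi).
      destruct (column_count f X T d _ _ x t t' Hd (Hc x) Hx Ht Ht' Cx Ct Ct')
        as (l & N & Hl & Hn).
      exists l. split; [exact N|]. split.
      - intros m Hm. destruct (Hl m Hm) as [HQ E]. rewrite E. auto.
      - eapply Rle_trans; [|exact Hn]. unfold Rdiv. apply Rmult_le_compat_r; [|lra].
        left; apply Rinv_0_lt_compat; lra. }
    exists l. split; [exact N|]. split.
    - intros m Hm. apply Hl in Hm. tauto.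
    - rewrite rsum_const in Hn.
      replace (INR k2 / d * V i) with (INR k2 * (V i / d)) by (field; lra). lra. }
  rewrite rsum_scal in Hn.
  replace (INR k2 * rsum V k1 / d) with (INR k2 / d * rsum V k1) by (field; lra).
  eapply Rle_trans; [exact Hn|]. apply le_INR, NoDup_incl_length; auto.
  intros m Hm. apply HL. apply Hl in Hm. apply Hm.
Qed.

(** [ln n] differs from [D * ln (1 / d)] by a bounded amount, which vanishes after division by
    [ln (1 / d)]. *)
Lemma has_box_dim_of_power_bounds A D c C d1 :
  0 < c -> 0 < C -> 0 < d1 ->
  (forall d, 0 < d < d1 -> exists n, box_count A d n /\
     c * Rpower d (- D) <= INR n <= C * Rpower d (- D)) ->
  has_box_dim A D.
Proof.
  intros Hc HC Hd1 H eps Heps.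
  set (B := Rabs (ln c) + Rabs (ln C) + 1).
  assert (HB : 0 < B) by (unfold B; generalize (Rabs_pos (ln c)) (Rabs_pos (ln C)); lra).
  (* Below this threshold [ln (1 / d) > B / eps]. *)
  exists (Rmin d1 (exp (- (B / eps)))). split.
  { apply Rmin_glb_lt; [lra|apply exp_pos]. }
  intros d [Hd0 Hd].
  assert (Hd2 : d < d1) by (eapply Rlt_le_trans; [exact Hd|apply Rmin_l]).
  assert (Hd3 : d < exp (- (B / eps))) by (eapply Rlt_le_trans; [exact Hd|apply Rmin_r]).
  destruct (H d (conj Hd0 Hd2)) as (n & Hn & Hl & Hu).
  exists n. split; [exact Hn|].
  assert (HL : B / eps < ln (1 / d)).
  { unfold Rdiv at 2. rewrite Rmult_1_l, ln_Rinv by lra.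
    apply ln_increasing in Hd3; [|lra]. rewrite ln_exp in Hd3. lra. }
  assert (HBe : 0 < B / eps) by (apply Rdiv_lt_0_compat; lra).
  assert (E : ln (1 / d) = - ln d) by (unfold Rdiv; rewrite Rmult_1_l, ln_Rinv by lra; lra).
  set (Ld := ln (1 / d)) in *.
  assert (Pd : 0 < Rpower d (- D)) by apply exp_pos.
  assert (Pn : 0 < INR n) by nra.
  assert (L1 : ln c + D * Ld <= ln (INR n)).
  { replace (ln c + D * Ld) with (ln (c * Rpower d (- D))).
    - apply ln_le; nra.
    - rewrite ln_mult by lra. unfold Rpower. rewrite ln_exp, E. ring. }
  assert (L2 : ln (INR n) <= ln C + D * Ld).
  { replace (ln C + D * Ld) with (ln (C * Rpower d (- D))).
    - apply ln_le; lra.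
    - rewrite ln_mult by lra. unfold Rpower. rewrite ln_exp, E. ring. }
  replace (ln (INR n) / Ld - D) with ((ln (INR n) - D * Ld) / Ld) by (field; lra).
  unfold Rdiv. rewrite Rabs_mult, (Rabs_pos_eq (/ Ld)) by (left; apply Rinv_0_lt_compat; lra).
  apply Rmult_lt_reg_r with Ld; [lra|]. rewrite Rmult_assoc, Rinv_l, Rmult_1_r by lra.
  apply Rlt_trans with B.
  - apply Rabs_lt_between. unfold B.
    generalize (Rabs_maj2 (ln c)) (Rle_abs (ln C)) (Rabs_pos (ln c)) (Rabs_pos (ln C)). lra.
  - apply Rmult_lt_compat_r with (r := eps) in HL; [|lra].
    replace (B / eps * eps) with B in HL by (field; lra). lra.
Qed.

(** * Oscillation from below *)

(** Five terms of the Leibniz series. The value is taken so that [PI / 4 <= 84 / 100], the range of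
    [sin_sq_lower]. *)
Lemma PI_upper : PI <= 336 / 100.
Proof.
  generalize (PI_ineq 2). simpl. unfold tg_alt, PI_tg. simpl. lra.
Qed.

Lemma cos_second_order (y : R) : 2 - 2 * cos y <= y ^ 2.
Proof.
  replace y with (2 * (y / 2)) at 1 by field. rewrite cos_2a_sin.
  generalize (Rabs_sin_le (y / 2)). intros H.
  assert (sin (y / 2) ^ 2 <= (y / 2) ^ 2).
  { rewrite <- (pow2_abs (sin (y / 2))), <- (pow2_abs (y / 2)).
    apply pow_incr; split; [apply Rabs_pos|exact H]. }
  nra.
Qed.

(** From [sin y >= y - y ^ 3 / 6]: here [1 - y ^ 2 / 6 >= 0.8824], whose square exceeds 0.778. *)
Lemma sin_sq_lower (y : R) : 0 <= y <= 84 / 100 -> 778 / 1000 * y ^ 2 <= sin y ^ 2.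
Proof.
  intros Hy. destruct (pre_sin_bound y 0) as [H _]; [lra|lra|].
  assert (E : sin_approx y (2 * 0 + 1) = y - y ^ 3 / 6).
  { unfold sin_approx, sin_term. simpl. field. }
  rewrite E in H.
  assert (H1 : 8824 / 10000 * y <= sin y) by nra.
  assert (0 <= 8824 / 10000 * y) by lra. nra.
Qed.

(* [h = 2 PI / q^(2(m+1))] is a period of every mode above the [m]-th. *)
Definition damping (q m n : nat) : R :=
  2 - 2 * cos (INR q ^ (2 * n) * (2 * PI / INR q ^ (2 * S m))).

Lemma damping_high q m k : (2 <= q)%nat -> damping q m (S m + k) = 0.
Proof.
  intros Hq. apply INR_ge2 in Hq. unfold damping.
  replace (INR q ^ (2 * (S m + k)) * (2 * PI / INR q ^ (2 * S m)))
    with (0 + 2 * INR (q ^ (2 * k)) * PI).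
  - rewrite cos_period, cos_0. ring.
  - rewrite pow_INR. replace (2 * (S m + k))%nat with (2 * k + 2 * S m)%nat by lia.
    rewrite pow_add. field. apply pow_nonzero. lra.
Qed.

Lemma damping_nonneg q m n : 0 <= damping q m n.
Proof. unfold damping. generalize (COS_bound (INR q ^ (2 * n) * (2 * PI / INR q ^ (2 * S m)))). lra. Qed.

Lemma damping_top q m : (2 <= q)%nat -> damping q m m = 4 * sin (PI / INR q ^ 2) ^ 2.
Proof.
  intros Hq. apply INR_ge2 in Hq. unfold damping.
  replace (INR q ^ (2 * m) * (2 * PI / INR q ^ (2 * S m))) with (2 * (PI / INR q ^ 2)).
  - rewrite cos_2a_sin. ring.
  - replace (2 * S m)%nat with (2 * m + 2)%nat by lia. rewrite pow_add.
    field. split; [|apply pow_nonzero]; lra.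
Qed.

(** Each mode is an eigenfunction of the second difference in [t], with eigenvalue
    [- damping q m n], which is zero for [n > m]. *)
Lemma mode_sum_second_difference g q s x t m :
  (2 <= q)%nat -> 0 < s < 2 -> trig_like g ->
  mode_sum g q s x (t + 2 * PI / INR q ^ (2 * S m))
    + mode_sum g q s x (t - 2 * PI / INR q ^ (2 * S m)) - 2 * mode_sum g q s x t
  = - rsum (fun n => coef q s n * sin (INR q ^ n * x) * damping q m n
                     * g (INR q ^ (2 * n) * t)) (S m).
Proof.
  intros Hq Hs Hg. set (h := 2 * PI / INR q ^ (2 * S m)). unfold mode_sum.
  rewrite <- Series_plus by (apply ex_series_mode_sum; auto).
  rewrite <- Series_scal_l, <- Series_minus.
  2: { apply (ex_series_plus (K := R_AbsRing) (V := R_NormedModule)); apply ex_series_mode_sum; auto. }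
  2: { apply (ex_series_scal (K := R_AbsRing) (V := R_NormedModule) 2), ex_series_mode_sum; auto. }
  set (u := fun n => coef q s n * sin (INR q ^ n * x) * damping q m n * g (INR q ^ (2 * n) * t)).
  rewrite (Series_ext _ (fun n => - u n)).
  2: { intros n. unfold u, damping. fold h. destruct Hg as (_ & _ & Hg).
       specialize (Hg (INR q ^ (2 * n) * t) (INR q ^ (2 * n) * h)).
       rewrite Rmult_plus_distr_l, Rmult_minus_distr_l.
       transitivity (coef q s n * sin (INR q ^ n * x) *
         ((g (INR q ^ (2 * n) * t + INR q ^ (2 * n) * h)
          + g (INR q ^ (2 * n) * t - INR q ^ (2 * n) * h)) - 2 * g (INR q ^ (2 * n) * t))).
       - ring.
       - rewrite Hg. ring. }
  rewrite Series_opp. f_equal. rewrite (Series_split u (S m)).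
  - rewrite (Series_ext (fun k => u (S m + k)%nat) (fun k => 0 * 0)).
    + rewrite Series_scal_l. ring.
    + intros k. unfold u. rewrite damping_high by auto. ring.
  - apply ex_series_ext with (fun n => ratio q s ^ n *
      (sin (INR q ^ n * x) * damping q m n * g (INR q ^ (2 * n) * t))).
    { intros n. unfold u. rewrite coef_pow.
      match goal with |- ?a = ?b => change (@eq R a b) end. ring. }
    apply (ex_series_geom_bounded _ 4); [apply ratio_bounds; auto|].
    intros n. destruct Hg as (Hg & _).
    specialize (Hg (INR q ^ (2 * n) * t)). apply Rabs_le_between in Hg.
    generalize (SIN_bound (INR q ^ n * x)). intros Hsin.
    assert (0 <= damping q m n <= 4).
    { unfold damping. generalize (COS_bound (INR q ^ (2 * n) * (2 * PI / INR q ^ (2 * S m)))). lra. }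
    assert (-4 <= sin (INR q ^ n * x) * damping q m n <= 4) by nra.
    apply Rabs_le. nra.
Qed.

Lemma rsum_geom_below (r : R) m : 4 <= r -> 3 * rsum (fun n => r ^ n) m <= r ^ m.
Proof.
  intros Hr. induction m as [|m IH]; simpl; [lra|].
  assert (0 < r ^ m) by (apply pow_lt; lra). nra.
Qed.

(* The constant must stay below [1/2], the mean of [sin^2]. *)
Lemma damping_low_frequencies q s m : (2 <= q)%nat -> 0 < s < 2 ->
  rsum (fun n => coef q s n * damping q m n) m
    <= 43 / 100 * (coef q s m * damping q m m).
Proof.
  intros Hq Hs.
  generalize (sq_ge4 q Hq) (ratio_bounds q s Hq Hs) (ratio_sq q s Hq Hs) PI_upper PI_RGT_0.
  intros Hw Hl Hlw Hpi Hpi0.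
  set (w := INR q ^ 2) in *. set (l := ratio q s) in *.
  set (h := 2 * PI / INR q ^ (2 * S m)).
  assert (Hwm : 0 < w ^ m) by (apply pow_lt; lra).
  assert (Eh : w ^ m * h = 2 * (PI / w)).
  { unfold h. rewrite (pow_mult _ 2). fold w. simpl. field. split; lra. }
  assert (Hh : 0 <= h).
  { unfold h. apply Rlt_le, Rdiv_lt_0_compat; [lra|]. apply pow_lt.
    apply INR_ge2 in Hq; lra. }
  apply Rle_trans with (h ^ 2 * rsum (fun n => (l * w ^ 2) ^ n) m).
  - rewrite <- rsum_scal. apply rsum_le. intros n _. rewrite coef_pow. fold l.
    apply Rle_trans with (l ^ n * (w ^ n * h) ^ 2).
    + apply Rmult_le_compat_l; [apply pow_le; lra|].
      unfold damping. rewrite (pow_mult _ 2 n). fold w. apply cos_second_order.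
    + right. rewrite !Rpow_mult_distr, <- !pow_mult.
      rewrite (Nat.mul_comm 2 n). ring.
  (* [l * w > 1] and [w >= 4] make the ratio [l * w ^ 2] at least 4, so the sum is at most a third
     of the next power. *)
  - assert (H3 := rsum_geom_below (l * w ^ 2) m ltac:(nra)).
    rewrite damping_top, coef_pow by auto. fold l w.
    set (y := PI / w) in *.
    assert (Hy : 0 <= y <= 84 / 100).
    { unfold y. split.
      - apply Rlt_le, Rdiv_lt_0_compat; lra.
      - apply Rmult_le_reg_r with w; [lra|]. unfold Rdiv. rewrite Rmult_assoc, Rinv_l by lra. nra. }
    generalize (sin_sq_lower y Hy); intros Hsin.
    assert (E : h ^ 2 * (l * w ^ 2) ^ m = l ^ m * (4 * y ^ 2)).
    { replace (4 * y ^ 2) with ((w ^ m * h) ^ 2) by (rewrite Eh; ring).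
      rewrite !Rpow_mult_distr, <- !pow_mult, (Nat.mul_comm 2 m). ring. }
    assert (Hlm : 0 < l ^ m) by (apply pow_lt; lra).
    (* It remains to compare [4 * y ^ 2 / 3] with [4 * sin y ^ 2], and [1 / (3 * 0.778) < 0.43]. *)
    assert (h ^ 2 * rsum (fun n => (l * w ^ 2) ^ n) m <= l ^ m * (4 * y ^ 2) / 3).
    { rewrite <- E. assert (0 <= h ^ 2) by nra. nra. }
    nra.
Qed.

(** * Phase alignment and the oscillation of the squared modulus *)

Lemma polar_angle (u v : R) : exists phi,
  u = sqrt (u ^ 2 + v ^ 2) * cos phi /\ v = sqrt (u ^ 2 + v ^ 2) * sin phi.
Proof.
  set (r := sqrt (u ^ 2 + v ^ 2)).
  assert (Hr2 : r * r = u ^ 2 + v ^ 2) by (apply sqrt_sqrt; nra).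
  assert (Hr : 0 <= r) by apply sqrt_pos.
  destruct (Req_dec r 0) as [H0|H0].
  - rewrite H0 in *. exists 0. split; nra.
  - assert (Hc : -1 <= u / r <= 1).
    { assert (Hu : - r <= u <= r).
      { apply Rabs_le_between. unfold r. rewrite <- sqrt_Rsqr_abs.
        apply sqrt_le_1_alt. unfold Rsqr. nra. }
      assert (Eu : u = u / r * r) by (field; auto). split; apply Rmult_le_reg_r with r; lra. }
    assert (E : sqrt (1 - Rsqr (u / r)) = Rabs v / r).
    { replace (1 - Rsqr (u / r)) with (Rsqr (v / r)).
      - rewrite sqrt_Rsqr_abs. unfold Rdiv. rewrite Rabs_mult, (Rabs_pos_eq (/ r)); auto.
        left; apply Rinv_0_lt_compat; lra.
      - unfold Rsqr. replace (1) with ((r * r) / (r * r)) by (field; auto).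
        rewrite Hr2 at 1. field. auto. }
    destruct (Rle_dec 0 v) as [Hv|Hv].
    + exists (acos (u / r)). rewrite cos_acos, sin_acos, E, Rabs_pos_eq by auto.
      split; field; auto.
    + exists (- acos (u / r)). rewrite cos_neg, sin_neg, cos_acos, sin_acos, E by auto.
      rewrite Rabs_left by lra. split; field; auto.
Qed.

Lemma cos_period_Z (x : R) (k : Z) : cos (x + 2 * IZR k * PI) = cos x.
Proof.
  destruct (Z_le_gt_dec 0 k) as [Hk|Hk].
  - rewrite <- (Z2Nat.id k Hk), <- INR_IZR_INZ. apply cos_period.
  - rewrite <- (cos_period (x + 2 * IZR k * PI) (Z.to_nat (- k))).
    rewrite INR_IZR_INZ, Z2Nat.id, opp_IZR by lia. f_equal. ring.
Qed.

(** With [phi] the argument of [u + i v], the angle [phi + PI] recurs in every window of length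
    [2 * PI]. *)
Lemma opposite_phase (u v a : R) : exists th, a <= th <= a + 2 * PI /\
  u * cos th + v * sin th = - sqrt (u ^ 2 + v ^ 2).
Proof.
  destruct (polar_angle u v) as (phi & Hu & Hv).
  set (r := sqrt (u ^ 2 + v ^ 2)) in *.
  generalize PI_RGT_0; intros Hpi.
  destruct (archimed ((a - (phi + PI)) / (2 * PI))) as [A1 A2].
  set (k := up ((a - (phi + PI)) / (2 * PI))) in *.
  set (y := (a - (phi + PI)) / (2 * PI)) in *.
  assert (E : a = phi + PI + 2 * y * PI) by (unfold y; field; lra).
  exists (phi + PI + 2 * IZR k * PI). split; [nra|].
  rewrite Hu, Hv at 1.
  transitivity (r * cos (phi + PI + 2 * IZR k * PI - phi)).
  - rewrite cos_minus. ring.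
  - replace (phi + PI + 2 * IZR k * PI - phi) with (PI + 2 * IZR k * PI) by ring.
    rewrite cos_period_Z, cos_PI. ring.
Qed.

Lemma projection_bound (u v th : R) :
  Rabs (u * cos th + v * sin th) <= sqrt (u ^ 2 + v ^ 2).
Proof.
  rewrite <- sqrt_Rsqr_abs. apply sqrt_le_1_alt. unfold Rsqr.
  generalize (sin2_cos2 th). unfold Rsqr. intros H.
  assert (0 <= (u * sin th - v * cos th) ^ 2) by apply pow2_ge_0.
  assert (E : u ^ 2 + v ^ 2 = (u ^ 2 + v ^ 2) * (sin th * sin th + cos th * cos th))
    by (rewrite H; ring).
  rewrite E. nra.
Qed.

(* Only two values at distance [h] from [t] have to be compared: the squares discarded
   from the second difference of [mode_sum cos ^ 2 + mode_sum sin ^ 2] are nonnegative. *)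
Lemma modulus_oscillation q s x tau m :
  (2 <= q)%nat -> 0 < s < 2 ->
  let tc := tau + 2 * PI / INR q ^ (2 * m) in
  let E t := mode_sum cos q s x t ^ 2 + mode_sum sin q s x t ^ 2 in
  1 / 16 <= E tc ->
  (forall g t, trig_like g -> tau <= t <= tau + 6 * PI / INR q ^ (2 * m) ->
     Rabs (mode_sum g q s x t - mode_sum g q s x tc) <= / 1000) ->
  exists t t', tau <= t <= tau + 6 * PI / INR q ^ (2 * m) /\
    tau <= t' <= tau + 6 * PI / INR q ^ (2 * m) /\
    ratio q s ^ m * sin (PI / INR q ^ 2) ^ 2 * (sin (INR q ^ m * x) ^ 2 - 45 / 100)
      <= E t' - E t.
Proof.
  intros Hq Hs tc E Hrho Hmod.
  generalize (sq_ge4 q Hq) (ratio_bounds q s Hq Hs) PI_RGT_0; intros Hw Hl Hpi.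
  assert (HW : 0 < INR q ^ (2 * m)) by (apply pow_lt; apply INR_ge2 in Hq; lra).
  set (W := INR q ^ (2 * m)) in *.
  set (p := 2 * PI / W) in *.
  assert (Hp : 0 < p) by (apply Rdiv_lt_0_compat; lra).
  replace (6 * PI / W) with (3 * p) in * by (unfold p; field; lra).
  set (S0 := sin (INR q ^ m * x)).
  set (u0 := mode_sum cos q s x tc). set (v0 := mode_sum sin q s x tc).
  set (rho := sqrt (u0 ^ 2 + v0 ^ 2)).
  assert (Hr4 : / 4 <= rho).
  { unfold rho. replace (/ 4) with (sqrt (1 / 16)).
    - apply sqrt_le_1_alt. exact Hrho.
    - replace (1 / 16) with (Rsqr (/ 4)) by (unfold Rsqr; field). apply sqrt_Rsqr. lra. }
  assert (HS : 0 <= Rabs S0 <= 1) by (split; [apply Rabs_pos|apply Rabs_le, SIN_bound]).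
  (* The [m]-th mode is aligned against the value of [F] at [tc], which is fixed before [t] is
     chosen. The sign of [S0] decides between the phase opposite to [(u0, v0)] and that opposite to
     its negative. *)
  assert (Halign : exists t, tc <= t <= tc + p /\
    S0 * (u0 * cos (W * t) + v0 * sin (W * t)) = - (Rabs S0 * rho)).
  { destruct (opposite_phase u0 v0 (W * tc)) as (th & Hth & Eth).
    destruct (opposite_phase (- u0) (- v0) (W * tc)) as (th' & Hth' & Eth').
    replace ((- u0) ^ 2 + (- v0) ^ 2) with (u0 ^ 2 + v0 ^ 2) in Eth' by ring.
    fold rho in Eth, Eth'.
    assert (Hin : forall y, W * tc <= y <= W * tc + 2 * PI -> tc <= y / W <= tc + p).
    { intros y Hy. assert (Ey : W * (y / W) = y) by (field; lra).
      assert (Ep : W * p = 2 * PI) by (unfold p; field; lra).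
      split; apply Rmult_le_reg_l with W; try lra; rewrite ?Rmult_plus_distr_l; lra. }
    destruct (Rle_dec 0 S0) as [H0|H0].
    - exists (th / W). split; [apply Hin; auto|].
      replace (W * (th / W)) with th by (field; lra).
      rewrite Rabs_pos_eq, Eth by lra. ring.
    - exists (th' / W). split; [apply Hin; auto|].
      replace (W * (th' / W)) with th' by (field; lra).
      rewrite Rabs_left by lra.
      replace (u0 * cos th' + v0 * sin th') with (- (- u0 * cos th' + - v0 * sin th')) by ring.
      rewrite Eth'. ring. }
  destruct Halign as (t & Ht & Hal).
  assert (Htc : tau + p = tc) by reflexivity.
  set (h := 2 * PI / INR q ^ (2 * S m)).
  (* As [t] lies in the middle third of the window of length [3 * p], both [t - h] and [t + h] stay
     inside it. *)
  assert (Hh : 0 <= h <= p).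
  { assert (Hw2 : h * INR q ^ 2 = p).
    { unfold h, p, W. replace (2 * S m)%nat with (2 * m + 2)%nat by lia.
      apply INR_ge2 in Hq. rewrite pow_add. field. split; [apply pow_nonzero; lra|lra]. }
    assert (0 <= h).
    { unfold h. apply Rlt_le, Rdiv_lt_0_compat; [lra|]. apply pow_lt; apply INR_ge2 in Hq; lra. }
    nra. }
  set (u := mode_sum cos q s x t). set (v := mode_sum sin q s x t).
  assert (Hu : Rabs (u - u0) <= / 1000) by (apply Hmod; [apply trig_like_cos|lra]).
  assert (Hv : Rabs (v - v0) <= / 1000) by (apply Hmod; [apply trig_like_sin|lra]).
  apply Rabs_le_between in Hu, Hv.
  set (G := fun n => u * cos (INR q ^ (2 * n) * t) + v * sin (INR q ^ (2 * n) * t)).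
  set (G0 := fun n => u0 * cos (INR q ^ (2 * n) * t) + v0 * sin (INR q ^ (2 * n) * t)).
  assert (HGG : forall n, Rabs (G n - G0 n) <= / 500).
  { intros n. unfold G, G0.
    generalize (COS_bound (INR q ^ (2 * n) * t)) (SIN_bound (INR q ^ (2 * n) * t)).
    intros Hc Hsn.
    replace (u * cos (INR q ^ (2 * n) * t) + v * sin (INR q ^ (2 * n) * t) -
      (u0 * cos (INR q ^ (2 * n) * t) + v0 * sin (INR q ^ (2 * n) * t)))
      with ((u - u0) * cos (INR q ^ (2 * n) * t) + (v - v0) * sin (INR q ^ (2 * n) * t)) by ring.
    apply Rabs_le. split; nra. }
  set (b := fun n => coef q s n * damping q m n).
  assert (Hb : forall n, 0 <= b n).
  { intros n. unfold b. apply Rmult_le_pos; [|apply damping_nonneg].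
    rewrite coef_pow. apply pow_le; lra. }
  set (D := rsum (fun n => b n * (sin (INR q ^ n * x) * G n)) (S m)).
  (* From [a ^ 2 - b ^ 2 >= 2 * b * (a - b)]: the second difference of [E] dominates twice the inner
     product of [(u, v)] with that of the two mode sums. *)
  assert (HD : E (t + h) - E t + (E (t - h) - E t) >= - (2 * D)).
  { generalize (mode_sum_second_difference cos q s x t m Hq Hs trig_like_cos)
      (mode_sum_second_difference sin q s x t m Hq Hs trig_like_sin).
    fold h u v.
    intros E1 E2.
    assert (ED : D = u * rsum (fun n => coef q s n * sin (INR q ^ n * x) * damping q m n
                     * cos (INR q ^ (2 * n) * t)) (S m)
      + v * rsum (fun n => coef q s n * sin (INR q ^ n * x) * damping q m n
                     * sin (INR q ^ (2 * n) * t)) (S m)).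
    { rewrite <- !rsum_scal, <- rsum_plus. apply rsum_ext. intros n _. unfold b, G. ring. }
    set (R1 := rsum _ _) in E1. set (R2 := rsum _ _) in E2.
    fold R1 R2 in ED. unfold E. fold u v.
    set (up := mode_sum cos q s x (t + h)) in *. set (um := mode_sum cos q s x (t - h)) in *.
    set (vp := mode_sum sin q s x (t + h)) in *. set (vm := mode_sum sin q s x (t - h)) in *.
    rewrite ED.
    replace R1 with (2 * u - up - um) by lra. replace R2 with (2 * v - vp - vm) by lra.
    generalize (pow2_ge_0 (up - u)) (pow2_ge_0 (um - u)) (pow2_ge_0 (vp - v)) (pow2_ge_0 (vm - v)).
    intros. nra. }
  assert (HDlow : rsum (fun n => b n * (sin (INR q ^ n * x) * G n)) m
                  <= 43 / 100 * b m * (rho + / 500)).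
  { apply Rle_trans with (rsum (fun n => (rho + / 500) * b n) m).
    - apply rsum_le. intros n _. rewrite (Rmult_comm _ (b n)).
      apply Rmult_le_compat_l; [apply Hb|].
      generalize (projection_bound u0 v0 (INR q ^ (2 * n) * t)) (HGG n) (SIN_bound (INR q ^ n * x)).
      fold rho. fold (G0 n). intros B1 B2 B3.
      apply Rabs_le_between in B1, B2.
      assert (- (rho + / 500) <= G n <= rho + / 500) by lra. nra.
    - rewrite rsum_scal.
      generalize (damping_low_frequencies q s m Hq Hs). fold b. fold (b m). nra. }
  assert (HDtop : S0 * G m <= - (Rabs S0 * rho) + / 500).
  { generalize (HGG m); intros B2. apply Rabs_le_between in B2.
    fold W in Hal. assert (EG0 : S0 * G0 m = - (Rabs S0 * rho)) by exact Hal.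
    assert (HS' : -1 <= S0 <= 1) by apply SIN_bound.
    nra. }
  (* Replacing [G] by [G0] costs [0.43 / 500] in the low modes and [1 / 500] in the [m]-th, together
     below [3 / 1000]. *)
  assert (HDm : - D >= b m * (rho * (Rabs S0 - 43 / 100) - 3 * / 1000)).
  { unfold D. simpl rsum. fold S0. generalize (Hb m). nra. }
  assert (Ebm : b m = 4 * (ratio q s ^ m * sin (PI / INR q ^ 2) ^ 2)).
  { unfold b. rewrite coef_pow, damping_top by auto. ring. }
  set (c := ratio q s ^ m * sin (PI / INR q ^ 2) ^ 2) in *.
  assert (Hc0 : 0 <= c) by (generalize (Hb m); lra).
  assert (HSS : S0 ^ 2 <= Rabs S0).
  { rewrite <- pow2_abs. nra. }
  (* When [S0 ^ 2 <= 0.45] the required gain is not positive, and [t' = t] will do. *)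
  destruct (Rle_dec (S0 ^ 2) (45 / 100)) as [Hsm|Hlg].
  - exists t, t. split; [lra|]. split; [lra|]. nra.
  - assert (HX : c * (S0 ^ 2 - 45 / 100) <= - D).
    { assert (S0 ^ 2 - 45 / 100 <= 4 * (rho * (Rabs S0 - 43 / 100) - 3 * / 1000)) by nra.
      nra. }
    (* The increments towards [t + h] and [t - h] sum to at least [- 2 * D], so one of them is at
       least [- D]. *)
    destruct (Rle_dec (c * (S0 ^ 2 - 45 / 100)) (E (t + h) - E t)) as [Hc1|Hc1].
    + exists t, (t + h). split; [lra|]. split; [lra|]. exact Hc1.
    + exists t, (t - h). split; [lra|]. split; [lra|]. lra.
Qed.

(** * Mean of [sin ^ 2] along an arithmetic progression, and the value of [F] at [(PI / 2, 0)] *)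

Lemma Dirichlet_kernel (y a : R) k :
  2 * sin y * rsum (fun i => cos (2 * y * (a + INR i))) k
  = sin (y * (2 * a + 2 * INR k - 1)) - sin (y * (2 * a - 1)).
Proof.
  induction k as [|k IH].
  - simpl. replace (y * (2 * a + 2 * 0 - 1)) with (y * (2 * a - 1)) by ring. ring.
  - cbn [rsum]. rewrite Rmult_plus_distr_l, IH, S_INR.
    set (z := 2 * y * (a + INR k)).
    replace (y * (2 * a + 2 * (INR k + 1) - 1)) with (z + y) by (unfold z; ring).
    replace (y * (2 * a + 2 * INR k - 1)) with (z - y) by (unfold z; ring).
    (* The sum telescopes: [2 * sin y * cos z = sin (z + y) - sin (z - y)]. *)
    rewrite sin_plus, sin_minus. ring.
Qed.

(** As [sin ^ 2] is half of one minus the cosine of the double angle, the deviation from the mean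
    1/2 is a Dirichlet sum, bounded independently of [k]. *)
Lemma rsum_sin_sq (y a : R) k : 0 < sin y ->
  INR k / 2 - / (2 * sin y) <= rsum (fun i => sin (y * (a + INR i)) ^ 2) k.
Proof.
  intros Hy. generalize (Dirichlet_kernel y a k). intros D.
  assert (E : rsum (fun i => sin (y * (a + INR i)) ^ 2) k
    = INR k / 2 - / 2 * rsum (fun i => cos (2 * y * (a + INR i))) k).
  { clear D. induction k as [|k IH]; [simpl; field|].
    cbn [rsum]. rewrite IH, S_INR.
    replace (2 * y * (a + INR k)) with (2 * (y * (a + INR k))) by ring.
    rewrite cos_2a_sin. field. }
  rewrite E. set (r := rsum (fun i => cos _) k) in *.
  assert (sin y * r <= 1).
  { generalize (SIN_bound (y * (2 * a + 2 * INR k - 1))) (SIN_bound (y * (2 * a - 1))). lra. }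
  assert (r <= / sin y).
  { apply Rmult_le_reg_l with (sin y); [lra|]. rewrite Rinv_r; lra. }
  rewrite Rinv_mult. lra.
Qed.

(** [c] is 0 for even [q], and 1 or -1 as [q] is 1 or 3 modulo 4. *)
Lemma sin_pow_half_PI q : exists c, -1 <= c <= 1 /\
  forall n, sin (INR q ^ n * (PI / 2)) = c ^ n.
Proof.
  assert (M1 : forall r, sin (INR (4 * r + 1) * (PI / 2)) = 1).
  { intros r. rewrite plus_INR, mult_INR.
    replace ((INR 4 * INR r + INR 1) * (PI / 2)) with (PI / 2 + 2 * INR r * PI)
      by (simpl; field). rewrite sin_period. apply sin_PI2. }
  assert (M3 : forall r, sin (INR (4 * r + 3) * (PI / 2)) = -1).
  { intros r. rewrite plus_INR, mult_INR.
    replace ((INR 4 * INR r + INR 3) * (PI / 2)) with (PI / 2 + PI + 2 * INR r * PI)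
      by (simpl; field). rewrite sin_period, neg_sin, sin_PI2. ring. }
  assert (Hdec : (exists p, q = 2 * p)%nat \/ (exists p, q = 4 * p + 1)%nat
                 \/ (exists p, q = 4 * p + 3)%nat).
  { assert (Hlt := Nat.mod_upper_bound q 4 ltac:(lia)).
    assert (Hdm := Nat.div_mod_eq q 4).
    destruct (q mod 4) as [|[|[|[|]]]]; [| | | |lia].
    - left. exists (2 * (q / 4))%nat. lia.
    - right; left. exists (q / 4)%nat. lia.
    - left. exists (2 * (q / 4) + 1)%nat. lia.
    - right; right. exists (q / 4)%nat. lia. }
  destruct Hdec as [[p Hp]|[[p Hp]|[p Hp]]].
  - exists 0. split; [lra|]. intros [|n].
    + simpl. rewrite Rmult_1_l. apply sin_PI2.
    + rewrite pow_i by lia. apply sin_eq_0_1. exists (Z.of_nat (p * q ^ n)).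
      rewrite <- INR_IZR_INZ, mult_INR, pow_INR. simpl.
      rewrite Hp at 1. rewrite mult_INR. simpl. field.
  - exists 1. split; [lra|]. intros n. rewrite pow1, <- pow_INR.
    assert (H : exists r, (q ^ n = 4 * r + 1)%nat).
    { induction n as [|n [r Hr]]; [exists 0%nat; reflexivity|].
      exists (4 * p * r + p + r)%nat. simpl. rewrite Hr, Hp. nia. }
    destruct H as [r ->]. apply M1.
  - exists (-1). split; [lra|]. intros n. rewrite <- pow_INR.
    assert (H : (exists r, (q ^ n = 4 * r + 1)%nat) /\ (-1) ^ n = 1 \/
                (exists r, (q ^ n = 4 * r + 3)%nat) /\ (-1) ^ n = -1).
    { induction n as [|n [[[r Hr] E]|[[r Hr] E]]].
      - left. split; [exists 0%nat; reflexivity|reflexivity].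
      - right. split; [|simpl; rewrite E; ring].
        exists (4 * p * r + p + 3 * r)%nat. simpl. rewrite Hr, Hp. nia.
      - left. split; [|simpl; rewrite E; ring].
        exists (4 * p * r + 3 * p + 3 * r + 2)%nat. simpl. rewrite Hr, Hp. nia. }
    destruct H as [[[r Hr] E]|[[r Hr] E]]; rewrite E, Hr; auto.
Qed.

(** At this point the series is geometric with sum [1 / (1 - c * ratio q s)], and the ratio exceeds
    -1. Near it [F] stays away from zero. *)
Lemma mode_sum_cos_half_PI q s : (2 <= q)%nat -> 0 < s < 2 ->
  / 2 <= mode_sum cos q s (PI / 2) 0.
Proof.
  intros Hq Hs. destruct (sin_pow_half_PI q) as (c & Hc & E).
  generalize (ratio_bounds q s Hq Hs); intros Hl. unfold mode_sum.
  rewrite (Series_ext _ (fun n => (c * ratio q s) ^ n)).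
  2: { intros n. rewrite coef_pow, E, Rmult_0_r, cos_0, Rpow_mult_distr. ring. }
  assert (-1 < c * ratio q s < 1) by nra.
  rewrite Series_geom by (apply Rabs_lt_between; lra).
  apply Rinv_le_contravar; lra.
Qed.

(** * The surface [P] *)

Lemma Nrm_sq_pos q s : (2 <= q)%nat -> 0 < s < 2 -> 0 < Nrm q s ^ 2.
Proof.
  intros Hq Hs. apply pow_lt. unfold Nrm. apply sqrt_lt_R0.
  apply INR_ge2 in Hq. generalize PI_RGT_0; intros Hpi.
  apply Rmult_lt_0_compat; [apply Rdiv_lt_0_compat; lra|].
  assert (Rpower (INR q) (2 * (s - 2)) < Rpower (INR q) 0) by (apply Rpower_lt; lra).
  rewrite Rpower_O in H by lra. lra.
Qed.

Lemma P_Hoelder q s : (2 <= q)%nat -> 0 < s < 2 ->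
  exists K, 0 < K /\ forall x t x' t' d, 0 < d <= 1 ->
    Rabs (x - x') <= d -> Rabs (t - t') <= d ->
    Rabs (P q s x t - P q s x' t') <= K * Rpower d (1 - s / 2).
Proof.
  intros Hq Hs. destruct (mode_sum_Hoelder q s Hq Hs) as (K & HK & HH).
  generalize (Nrm_sq_pos q s Hq Hs) (ratio_bounds q s Hq Hs); intros HN Hl.
  set (M := / (1 - ratio q s)).
  assert (HM : 0 < M) by (apply Rinv_0_lt_compat; lra).
  (* Each of the two squares changes by at most [2 * M] times the change of its mode sum. *)
  exists (Nrm q s ^ 2 * (4 * M * K)). split.
  { apply Rmult_lt_0_compat; [lra|]. apply Rmult_lt_0_compat; lra. }
  intros x t x' t' d Hd Hx Ht. rewrite !P_mode_sum.
  rewrite <- Rmult_minus_distr_l, Rabs_mult, (Rabs_pos_eq (Nrm q s ^ 2)), Rmult_assoc by lra.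
  apply Rmult_le_compat_l; [lra|].
  assert (B : forall g, trig_like g ->
    Rabs (mode_sum g q s x t ^ 2 - mode_sum g q s x' t' ^ 2)
      <= 2 * M * (K * Rpower d (1 - s / 2))).
  { intros g Hg.
    replace (mode_sum g q s x t ^ 2 - mode_sum g q s x' t' ^ 2)
      with ((mode_sum g q s x t + mode_sum g q s x' t')
            * (mode_sum g q s x t - mode_sum g q s x' t')) by ring.
    rewrite Rabs_mult. apply Rmult_le_compat; try apply Rabs_pos.
    - eapply Rle_trans; [apply Rabs_triang|].
      generalize (mode_sum_bound g q s x t Hq Hs Hg) (mode_sum_bound g q s x' t' Hq Hs Hg).
      fold M. lra.
    - apply HH; auto. }
  generalize (B cos trig_like_cos) (B sin trig_like_sin); intros B1 B2.
  apply Rabs_le_between in B1, B2. apply Rabs_le. lra.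
Qed.

Lemma Rpower_small (K al eps : R) : 0 < K -> 0 < al -> 0 < eps ->
  exists eta, 0 < eta <= 1 /\ forall d, 0 < d <= eta -> K * Rpower d al <= eps.
Proof.
  intros HK Hal Heps.
  exists (Rmin 1 (Rpower (eps / K) (/ al))).
  assert (P0 : 0 < Rpower (eps / K) (/ al)) by apply exp_pos.
  assert (PK : 0 < eps / K) by (apply Rdiv_lt_0_compat; lra).
  split; [split; [apply Rmin_glb_lt; lra|apply Rmin_l]|].
  intros d [Hd1 Hd2].
  assert (Hd3 : d <= Rpower (eps / K) (/ al)) by (eapply Rle_trans; [exact Hd2|apply Rmin_r]).
  assert (H : Rpower d al <= Rpower (Rpower (eps / K) (/ al)) al)
    by (apply Rle_Rpower_l; lra).
  rewrite Rpower_mult, Rinv_l, Rpower_1 in H by lra.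
  apply Rmult_le_compat_l with (r := K) in H; [|lra].
  replace (K * (eps / K)) with eps in H by (field; lra). exact H.
Qed.

Lemma P_continuity q s x : (2 <= q)%nat -> 0 < s < 2 -> continuity (P q s x).
Proof.
  intros Hq Hs t. destruct (P_Hoelder q s Hq Hs) as (K & HK & HH).
  intros eps Heps.
  destruct (Rpower_small K (1 - s / 2) (eps / 2)) as (eta & Heta & He); [lra|lra|lra|].
  exists eta. split; [lra|]. simpl. unfold Rdist. intros t' [_ Ht'].
  eapply Rle_lt_trans.
  - apply HH with (d := eta); [lra| |lra]. rewrite Rminus_diag, Rabs_R0. lra.
  - specialize (He eta ltac:(lra)). lra.
Qed.

(** Splits the count into [1 / d] for each horizontal direction and [d ^ (1 - s / 2) / d] for the
    height of a column. *)
Lemma Rpower_dim (d s : R) : 0 < d ->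
  Rpower d (- (2 + s / 2)) = Rpower d (1 - s / 2) * / d * / d * / d.
Proof.
  intros Hd. replace (- (2 + s / 2)) with ((1 - s / 2) + - INR 3) by (simpl; field).
  rewrite Rpower_plus, Rpower_Ropp, Rpower_pow by lra. field. lra.
Qed.

(** * Box counts of the surface from above and from below *)

Lemma graphP_count_upper q s T : (2 <= q)%nat -> 0 < s < 2 -> 0 < T ->
  exists C, 0 < C /\ forall d, 0 < d <= 1 -> exists n, box_count (graphP q s T) d n /\
    INR n <= C * Rpower d (- (2 + s / 2)).
Proof.
  intros Hq Hs HT. destruct (P_Hoelder q s Hq Hs) as (K & HK & HH).
  generalize PI_RGT_0; intros Hpi.
  exists ((PI + 3) * ((T + 3) * (2 * K + 3))). split.
  { repeat apply Rmult_lt_0_compat; lra. }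
  intros d Hd.
  assert (Hdi : 1 <= / d) by (rewrite <- Rinv_1; apply Rinv_le_contravar; lra).
  assert (Hp : 0 < Rpower d (1 - s / 2)) by apply exp_pos.
  (* This absorbs the additive 3 in the number of boxes of a column. *)
  assert (Hpd : 1 <= Rpower d (1 - s / 2) * / d).
  { replace 1 with (d * / d) at 1 by (field; lra). apply Rmult_le_compat_r; [lra|].
    rewrite <- (Rpower_1 d) at 1 by lra. unfold Rpower.
    assert (ln d <= 0) by (rewrite <- ln_1; apply ln_le; lra).
    destruct (Req_dec (ln d) 0) as [E|E]; [rewrite E, !Rmult_0_r; lra|].
    left. apply exp_increasing. nra. }
  destruct (graph_box_count_upper (P q s) PI T d (K * Rpower d (1 - s / 2)))
    as (n & Hn & Hle); try lra.
  { nra. }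
  { intros; apply HH; auto. }
  exists n. split; [exact Hn|]. eapply Rle_trans; [exact Hle|].
  rewrite Rpower_dim by lra. set (r := Rpower d (1 - s / 2)) in *.
  replace ((PI + 3) * ((T + 3) * (2 * K + 3)) * (r * / d * / d * / d))
    with (((PI + 3) * / d) * (((T + 3) * / d) * ((2 * K + 3) * (r * / d)))) by ring.
  unfold Rdiv.
  assert (0 < T * / d) by (apply Rmult_lt_0_compat; lra).
  assert (0 < PI * / d) by (apply Rmult_lt_0_compat; lra).
  assert (0 < K * (r * / d)) by (apply Rmult_lt_0_compat; lra).
  apply Rmult_le_compat; [lra| | lra |].
  - apply Rmult_le_pos; lra.
  - apply Rmult_le_compat; lra.
Qed.

(** Counting over a block of cells next to [(PI / 2, 0)], of side about [eta] independent of [d],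
    already gives the right exponent. *)
Lemma graphP_count_lower q s T : (2 <= q)%nat -> 0 < s < 2 -> 0 < T ->
  exists c d1, 0 < c /\ 0 < d1 /\ forall d n, 0 < d < d1 -> box_count (graphP q s T) d n ->
    c * Rpower d (- (2 + s / 2)) <= INR n.
Proof.
  intros Hq Hs HT. destruct (mode_sum_Hoelder q s Hq Hs) as (K & HK & HH).
  generalize PI_RGT_0 (sq_ge4 q Hq) (ratio_bounds q s Hq Hs) (Nrm_sq_pos q s Hq Hs).
  intros Hpi Hw Hl HN.
  (* Within [eta0] of [(PI / 2, 0)] the real part of [F] stays at least 1/4, hence the 1/16 in
     [modulus_oscillation]; [eta1] provides its tolerance 1/1000. *)
  destruct (Rpower_small K (1 - s / 2) (/ 4)) as (eta0 & Heta0 & He0); [lra|lra|lra|].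
  destruct (Rpower_small K (1 - s / 2) (/ 1000)) as (eta1 & Heta1 & He1); [lra|lra|lra|].
  set (eta := Rmin eta0 T).
  assert (Heta : 0 < eta <= 1 /\ eta <= eta0 /\ eta <= T).
  { unfold eta. generalize (Rmin_l eta0 T) (Rmin_r eta0 T).
    assert (0 < Rmin eta0 T) by (apply Rmin_glb_lt; lra).
    intros; repeat split; lra. }
  assert (HetaPI : eta <= PI / 2) by (generalize PI2_1; lra).
  set (w := INR q ^ 2) in *.
  set (sy := sin (PI / w)).
  assert (Hsy : 0 < sy ^ 2).
  { apply pow_lt, sin_gt_0; [apply Rdiv_lt_0_compat; lra|].
    apply Rmult_lt_reg_r with w; [lra|]. unfold Rdiv. rewrite Rmult_assoc, Rinv_l by lra. nra. }
  set (c1 := Rpower (6 * PI * w) (- (1 - s / 2))).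
  assert (Hc1 : 0 < c1) by apply exp_pos.
  assert (Hden : 0 < 6 * PI * w) by (apply Rmult_lt_0_compat; lra).
  (* In order: small variation on a cell, [k >= eta / (2 * d)], [y * eta >= 50 * d], and
     [y ^ 2 <= 1 / 2]. *)
  set (d1 := Rmin (Rmin eta1 (eta / 4)) (Rmin (eta * eta / 2500) (/ (2 * (6 * PI * w))))).
  (* [k >= eta / (2 * d)] enters twice and the mean gain is at least 1/100, whence the 400. *)
  exists (Nrm q s ^ 2 * sy ^ 2 * c1 * (eta * eta / 400)), d1.
  split; [|split].
  { apply Rmult_lt_0_compat; [|nra].
    apply Rmult_lt_0_compat; [|lra]. apply Rmult_lt_0_compat; lra. }
  { unfold d1. repeat apply Rmin_glb_lt; try lra; [nra|]. apply Rinv_0_lt_compat; lra. }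
  intros d n [Hd0 Hd] Hn.
  assert (Hd' : d < eta1 /\ d < eta / 4 /\ d < eta * eta / 2500 /\ d < / (2 * (6 * PI * w))).
  { unfold d1 in Hd.
    apply Rmin_Rgt_l in Hd as [Hd Hd'].
    apply Rmin_Rgt_l in Hd as [? ?]. apply Rmin_Rgt_l in Hd' as [? ?].
    repeat split; assumption. }
  destruct Hd' as (Hda & Hdb & Hdc & Hdd).
  assert (Hdd' : 6 * PI * w * d <= / 2).
  { apply Rmult_lt_compat_l with (r := 6 * PI * w) in Hdd; [|lra].
    rewrite Rinv_mult in Hdd.
    replace (6 * PI * w * (/ 2 * / (6 * PI * w))) with (/ 2) in Hdd by (field; lra). lra. }
  (* Three periods of the [m]-th mode, [6 * PI / w ^ m], then fit into one cell, and [m] is not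
     larger than needed. *)
  destruct (pow_bracket w (6 * PI / d)) as (m & Hm1 & Hm2); [lra| |].
  { apply Rmult_le_reg_r with d; [lra|]. unfold Rdiv. rewrite Rmult_assoc, Rinv_l by lra.
    generalize PI2_1; nra. }
  assert (Hm : 6 * PI <= w ^ m * d <= 6 * PI * w).
  { replace (6 * PI) with (6 * PI / d * d) by (field; lra). split.
    - apply Rmult_le_compat_r; lra.
    - replace (6 * PI / d * d * w) with (6 * PI / d * w * d) by ring.
      apply Rmult_le_compat_r; lra. }
  assert (Hwm : 0 < w ^ m) by (apply pow_lt; lra).
  destruct (ratio_pow_Rpower q s (6 * PI) d m Hq Hs) as [Hlm _]; [lra|lra|exact Hm|].
  fold w in Hlm. fold c1 in Hlm.
  set (r := Rpower d (1 - s / 2)) in *.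
  assert (Hr : 0 < r) by apply exp_pos.
  destruct (base_Int_part (eta / d)) as [F1 F2].
  (* One cell is given up because the grid need not be aligned with [PI / 2 - eta]. *)
  set (k := Z.to_nat (Int_part (eta / d) - 1)).
  assert (Hed : 4 <= eta / d).
  { apply Rmult_le_reg_r with d; [lra|]. unfold Rdiv. rewrite Rmult_assoc, Rinv_l by lra. lra. }
  assert (Hk : eta / d - 2 <= INR k <= eta / d - 1).
  { unfold k. rewrite INR_IZR_INZ, Z2Nat.id.
    - rewrite minus_IZR. lra.
    - assert (0 < Int_part (eta / d))%Z by (apply lt_IZR; lra). lia. }
  assert (Ekd : eta = eta / d * d) by (field; lra).
  destruct (archimed ((PI / 2 - eta) / d)) as [A1 A2].
  set (a1 := up ((PI / 2 - eta) / d)) in *.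
  assert (Ea : PI / 2 - eta = (PI / 2 - eta) / d * d) by (field; lra).
  (* At the left edges of the cells, [q ^ m * x] runs through an arithmetic progression of step
     [y]. *)
  set (y := INR q ^ m * d).
  set (V := fun i => Nrm q s ^ 2 * (ratio q s ^ m * sy ^ 2)
              * (sin (y * (IZR a1 + INR i)) ^ 2 + - (45 / 100))).
  assert (HL : INR k * rsum V k / d <= INR n).
  { apply (graph_box_count_lower (P q s) PI T d a1 0 k k V n Hd0); [| |exact Hn].
    { intros x. apply P_continuity; auto. }
    intros i j Hi Hj.
    apply le_INR in Hi, Hj. rewrite S_INR in Hi, Hj.
    assert (Hi0 := pos_INR i). assert (Hj0 := pos_INR j).
    set (x := (IZR a1 + INR i) * d).
    assert (Hx : PI / 2 - eta <= x <= PI / 2).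
    { unfold x. split.
      - rewrite Ea. apply Rmult_le_compat_r; lra.
      - replace (PI / 2) with ((PI / 2 - eta) / d * d + eta / d * d) by (field; lra).
        rewrite <- Rmult_plus_distr_r. apply Rmult_le_compat_r; lra. }
    assert (Hjd : (INR j + 1) * d <= eta).
    { rewrite Ekd. apply Rmult_le_compat_r; lra. }
    set (tau := INR j * d).
    assert (Htau : 0 <= tau) by (apply Rmult_le_pos; lra).
    assert (Ewm : INR q ^ (2 * m) = w ^ m) by (unfold w; apply pow_mult).
    assert (H6 : 0 <= 6 * PI / w ^ m <= d).
    { split; [apply Rlt_le, Rdiv_lt_0_compat; lra|].
      apply Rmult_le_reg_r with (w ^ m); [lra|]. unfold Rdiv.
      rewrite Rmult_assoc, Rinv_l by lra. lra. }
    assert (H2 : 0 <= 2 * PI / w ^ m <= d).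
    { unfold Rdiv in *. split; [apply Rlt_le, Rdiv_lt_0_compat; lra|].
      assert (0 < PI * / w ^ m) by (apply Rdiv_lt_0_compat; lra). lra. }
    destruct (modulus_oscillation q s x tau m Hq Hs) as (t & t' & Ht & Ht' & Hosc).
    - rewrite Ewm. set (tc := tau + 2 * PI / w ^ m).
      assert (HU : Rabs (mode_sum cos q s x tc - mode_sum cos q s (PI / 2) 0) <= / 4).
      { eapply Rle_trans; [apply HH with (d := eta)|].
        - apply trig_like_cos.
        - lra.
        - apply Rabs_le. lra.
        - apply Rabs_le. unfold tc. unfold tau in *. lra.
        - apply He0. lra. }
      apply Rabs_le_between in HU. generalize (mode_sum_cos_half_PI q s Hq Hs). intros.
      generalize (pow2_ge_0 (mode_sum sin q s x tc)). nra.
    - rewrite Ewm. intros g t Hg Ht.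
      eapply Rle_trans; [apply HH with (d := d)|].
      + exact Hg.
      + lra.
      + rewrite Rminus_diag, Rabs_R0. lra.
      + apply Rabs_le. lra.
      + apply He1. lra.
    - rewrite Ewm in *. fold w in Hosc. fold sy in Hosc.
      assert (Ex : IZR (a1 + Z.of_nat i) * d = x)
        by (rewrite plus_IZR, <- INR_IZR_INZ; reflexivity).
      assert (Et : IZR (0 + Z.of_nat j) = INR j)
        by (rewrite Z.add_0_l, <- INR_IZR_INZ; reflexivity).
      exists x, t, t'. rewrite Et. rewrite Rmult_plus_distr_r, Ex.
      rewrite (Rmult_plus_distr_r (INR j)). rewrite Rmult_plus_distr_r in Hjd.
      fold tau in Hjd |- *.
      split; [lra|]. split; [lra|]. split; [lra|]. split; [lra|].
      split; [lra|]. split; [lra|].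
      rewrite !P_mode_sum, <- Rmult_minus_distr_l. unfold V. rewrite Rmult_assoc.
      apply Rmult_le_compat_l; [lra|].
      replace (y * (IZR a1 + INR i)) with (INR q ^ m * x) by (unfold x, y; ring).
      exact Hosc. }
  assert (Hq0 : 0 < INR q ^ m) by (apply pow_lt; apply INR_ge2 in Hq; lra).
  assert (Hy0 : 0 < y) by (apply Rmult_lt_0_compat; lra).
  assert (Ey : y ^ 2 = w ^ m * d * d).
  { unfold y, w. rewrite Rpow_mult_distr, <- !pow_mult, (Nat.mul_comm m 2). ring. }
  assert (Hy1 : d <= y ^ 2) by (rewrite Ey; generalize PI2_1; nra).
  assert (Hy2 : y ^ 2 <= / 2) by (rewrite Ey; nra).
  assert (Hy3 : 0 <= y <= 84 / 100) by nra.
  assert (Hsin0 : 0 < sin y) by (apply sin_gt_0; generalize PI2_1; lra).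
  assert (Hsin : y / 2 <= sin y) by (generalize (sin_sq_lower y Hy3); nra).
  assert (Hyd : 50 * d <= y * eta) by nra.
  assert (Hk2 : eta / d / 2 <= INR k) by lra.
  assert (Hky : 25 <= INR k * y).
  { apply Rle_trans with (eta / d / 2 * y); [|apply Rmult_le_compat_r; lra].
    apply Rmult_le_reg_r with d; [lra|].
    replace (eta / d / 2 * y * d) with (y * eta / 2) by (field; lra). lra. }
  (* The block is long enough, [k * y >= 25], for the boundary term to stay below [0.04 * k]. *)
  assert (Hinv : / (2 * sin y) <= 4 / 100 * INR k).
  { apply Rle_trans with (/ y).
    - apply Rinv_le_contravar; lra.
    - apply Rmult_le_reg_r with y; [lra|]. rewrite Rinv_l; lra. }
  (* The margin: [0.5 - 0.04 - 0.45 = 0.01]. *)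
  assert (Hsum : / 100 * INR k <= rsum (fun i => sin (y * (IZR a1 + INR i)) ^ 2 + - (45 / 100)) k).
  { rewrite rsum_plus, rsum_const. generalize (rsum_sin_sq y (IZR a1) k Hsin0). lra. }
  unfold V in HL. rewrite rsum_scal in HL.
  eapply Rle_trans; [|exact HL].
  rewrite Rpower_dim by lra. fold r.
  set (Sg := rsum _ k) in *.
  set (kk := eta / d / 2) in *.
  assert (Hkk : 0 <= kk) by (unfold kk; lra).
  replace (Nrm q s ^ 2 * sy ^ 2 * c1 * (eta * eta / 400) * (r * / d * / d * / d))
    with (kk * (Nrm q s ^ 2 * ((c1 * r) * sy ^ 2) * (/ 100 * kk)) / d)
    by (unfold kk; field; lra).
  unfold Rdiv. apply Rmult_le_compat_r; [left; apply Rinv_0_lt_compat; lra|].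
  assert (Hcr : 0 < c1 * r) by (apply Rmult_lt_0_compat; lra).
  assert (Hcs : 0 <= Nrm q s ^ 2 * (c1 * r * sy ^ 2)).
  { apply Rmult_le_pos; [lra|]. apply Rmult_le_pos; lra. }
  apply Rmult_le_compat; [lra| |lra|].
  - apply Rmult_le_pos; lra.
  - apply Rmult_le_compat; [lra|lra| |lra].
    apply Rmult_le_compat_l; [lra|]. apply Rmult_le_compat_r; lra.
Qed.

Theorem theorem1 (q : nat) (s T : R) :
  (2 <= q)%nat -> 0 < s < 2 -> 0 < T ->
  has_box_dim (graphP q s T) (2 + s / 2).
Proof.
  intros Hq Hs HT.
  destruct (graphP_count_upper q s T Hq Hs HT) as (C & HC & Hu).
  destruct (graphP_count_lower q s T Hq Hs HT) as (c & d1 & Hc & Hd1 & Hl).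
  apply has_box_dim_of_power_bounds with c C (Rmin 1 d1); auto.
  { apply Rmin_glb_lt; lra. }
  intros d [Hd0 Hd]. apply Rmin_Rgt_l in Hd as [Hda Hdb].
  destruct (Hu d ltac:(lra)) as (n & Hn & Hle).
  exists n. split; [exact Hn|]. split; [|exact Hle]. apply Hl; auto.
Qed.
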